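(* Let $\Phi$ be a state on $\mathcal{A}^{\mathbb{Z}}$ and $\Theta\subseteq\mathcal{S}_{\mathrm{erg}}(\mathcal{A}^{\mathbb{Z}})$. The following are equivalent: 1. For each $\Psi\in\Theta$ the pair $(\Psi,\Phi)$ satisfies the HP-condition. 2. The relative entropy rate $s(\Psi,\Phi)\in[0,+\infty]$ exists for each $\Psi\in\Theta$, and for every subset $\Omega\subseteq\Theta$ and every $\eta>0$ there is a sequence of projections $p_n\in\mathcal{A}^{(n)}$ such that $\lim_{n\to\infty}\Psi^{(n)}(p_n)=1$ for all $\Psi\in\Omega$, and - if $s(\Omega,\Phi)<\infty$: $\limsup_{n\to\infty}\frac1n\log\Phi^{(n)}(p_n)\le -s(\Omega,\Phi)+\eta$; - if $s(\Omega,\Phi)=\infty$: $\limsup_{n\to\infty}\frac1n\log\Phi^{(n)}(p_n)\le -1/\eta$; and moreover every sequence of projections $\tilde p_n\in\mathcal{A}^{(n)}$ with $\lim_{n}\Psi^{(n)}(\tilde p_n)=1$ for all $\Psi\in\Omega$ satisfies $\liminf_{n\to\infty}\frac1n\log\Phi^{(n)}(\tilde p_n)\ge -s(\Omega,\Phi)$.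
   Context: $\mathcal{A}$ is a finite-dimensional $C^*$-algebra, $\mathcal{A}\cong\bigoplus_{i=1}^m M_{k_i}(\mathbb{C})$, with canonical trace $\mathrm{Tr}$ (sum of the matrix traces). For finite $T\subset\mathbb{Z}$ let $\mathcal{A}^T=\bigotimes_{t\in T}\mathcal{A}$, with the canonical embeddings $\mathcal{A}^T\subset\mathcal{A}^{T'}$ for $T\subset T'$; $\mathcal{A}^{\mathbb{Z}}$ is the norm completion of $\bigcup_T\mathcal{A}^T$ (quasilocal algebra). A state is a positive linear functional with value $1$ at the unit. For a state $\Psi$ on $\mathcal{A}^{\mathbb{Z}}$, $\Psi^{(T)}$ is its restriction to $\mathcal{A}^T$; $\mathcal{A}^{(n)}:=\mathcal{A}^{\{0,\dots,n-1\}}$, $\Psi^{(n)}:=\Psi^{(\{0,\dots,n-1\})}$, and $D_{\Psi^{(n)}}$ is its density operator ($\Psi^{(n)}(X)=\mathrm{Tr}(D_{\Psi^{(n)}}X)$). $\tau$ is the canonical shift on $\mathcal{A}^{\mathbb{Z}}$; $\mathcal{S}_{\mathrm{stat}}(\mathcal{A}^{\mathbb{Z}})$ is the set of $\tau$-invariant states and $\mathcal{S}_{\mathrm{erg}}(\mathcal{A}^{\mathbb{Z}})$ its extreme points (ergodic states). For states $\psi,\varphi$ on a finite-dimensional $C^*$-algebra, $S(\psi,\varphi)=\mathrm{Tr}\,D_\psi(\log D_\psi-\log D_\varphi)$ if $\mathrm{supp}(\psi)\le\mathrm{supp}(\varphi)$ and $+\infty$ otherwise. The relative entropy rate is $s(\Psi,\Phi):=\lim_{n}\frac1nS(\Psi^{(n)},\Phi^{(n)})$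 when this limit exists in $[0,+\infty]$; for a set $\Omega$ of states for which all these rates exist, $s(\Omega,\Phi):=\inf_{\Psi\in\Omega}s(\Psi,\Phi)$. For $\varepsilon\in(0,1)$, $\beta_{\varepsilon,n}(\Psi,\Phi):=\min\{\log\Phi(q): q\in\mathcal{A}^{(n)}\text{ projection},\ \Psi(q)\ge1-\varepsilon\}$ and $\bar\beta_\varepsilon(\Psi,\Phi):=\limsup_n\frac1n\beta_{\varepsilon,n}(\Psi,\Phi)$. The pair $(\Psi,\Phi)$ satisfies the HP-condition if $s(\Psi,\Phi)$ exists (in $[0,\infty]$) and $\bar\beta_\varepsilon(\Psi,\Phi)\le -s(\Psi,\Phi)$ for all $\varepsilon\in(0,1)$. *)

(* Defs.v *)
From HB Require Import structures.
From mathcomp Require Import all_boot all_order all_algebra.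
From mathcomp Require Import spectral.
From mathcomp Require Import complex.
From mathcomp Require Import boolp classical_sets reals ereal topology
  normedtype sequences exp.

Set Implicit Arguments.
Unset Strict Implicit.
Unset Printing Implicit Defensive.

Import Order.TTheory GRing.Theory Num.Theory.
Import numFieldNormedType.Exports.
Local Open Scope ring_scope.
Local Open Scope classical_set_scope.

(* Quantum spin chains over a finite-dimensional C*-algebra                   *)
(*   A = (+)_{b < m} M_{k b}(C),  C = R[i].                                   *)
(* A is realised as the block-diagonal *-subalgebra of matrices indexed by    *)
(* site := {b : 'I_m & 'I_(k b)}; the canonical trace is the matrix trace.   *)
(* A^(n) = A^{x n} is realised as the subalgebra of matrices indexed by       *)
(* configurations cfg n := {ffun 'I_n -> site} whose entries (i,j) vanish     *)
(* unless the block labels of i t and j t agree for every t (this is exactly  *)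
(* the span of the elementary tensors X_0 (x) ... (x) X_{n-1}, X_t in A).     *)
(* A state on the quasilocal algebra A^Z is represented by the (consistent)   *)
(* family of density operators of its restrictions to the intervals          *)
(* {a, ..., a+n-1}, a : int, n : nat (states on A^Z correspond one-to-one to   *)
(* such consistent families).                                                 *)

Section QuantumSpinChain.
Context {R : realType} {m : nat} (k : 'I_m -> nat).

Local Notation C := (R[i]).

Definition site : finType := {b : 'I_m & 'I_(k b)}.
Definition cfg (n : nat) : finType := {ffun 'I_n -> site}.

(* matrices on (C^site)^{(x) n} *)
Definition lmx (n : nat) := 'M[C]_(#|cfg n|).

Definition ent n (X : lmx n) (i j : cfg n) : C := X (enum_rank i) (enum_rank j).
Definition mkmx n (f : cfg n -> cfg n -> C) : lmx n :=
  \matrix_(a, b) f (enum_val a) (enum_val b).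

Definition inloc n (X : lmx n) : Prop :=
  forall i j : cfg n, ent X i j != 0 -> forall t, tag (i t) = tag (j t).

Definition adj n (X : lmx n) : lmx n := (map_mx Num.conj X)^T.

Definition psd n (X : lmx n) : Prop :=
  forall v : 'cV[C]_(#|cfg n|), 0 <= ((map_mx Num.conj v)^T *m X *m v) 0 0.

Definition density n (D : lmx n) : Prop := [/\ inloc D, psd D & \tr D = 1].

Definition projection n (q : lmx n) : Prop :=
  [/\ inloc q, adj q = q & q *m q = q].

(* value of the state with density D at X (real part; it is real on the     *)
(* positive elements, in particular on projections)                          *)
Definition stval n (D X : lmx n) : R := complex.Re (\tr (D *m X)).

(* embeddings A^(n) -> A^(n+1):  X |-> X (x) 1  and  X |-> 1 (x) X *)
Definition restrR n (f : cfg n.+1) : cfg n := [ffun t => f (widen_ord (leqnSn n) t)].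
Definition restrL n (f : cfg n.+1) : cfg n := [ffun t => f (lift ord0 t)].

Definition extR n (X : lmx n) : lmx n.+1 :=
  mkmx (fun i j => if i ord_max == j ord_max then ent X (restrR i) (restrR j) else 0).
Definition extL n (X : lmx n) : lmx n.+1 :=
  mkmx (fun i j => if i ord0 == j ord0 then ent X (restrL i) (restrL j) else 0).

(* a (candidate) state on A^Z: Phi a n = density of the restriction of Phi to *)
(* the sites {a, ..., a + n - 1}                                              *)
Definition qstate := forall (a : int) (n : nat), lmx n.

Definition is_state (Phi : qstate) : Prop :=
  [/\ forall a n, density (Phi a n),
      forall a n (X : lmx n), inloc X ->
        \tr (Phi a n.+1 *m extR X) = \tr (Phi a n *m X)
    & forall a n (X : lmx n), inloc X ->
        \tr (Phi (a - 1)%R n.+1 *m extL X) = \tr (Phi a n *m X)].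

Definition stationary (Phi : qstate) : Prop :=
  is_state Phi /\ forall a n, Phi (a + 1)%R n = Phi a n.

Definition ergodic (Psi : qstate) : Prop :=
  stationary Psi /\
  forall (Psi1 Psi2 : qstate) (t : R), stationary Psi1 -> stationary Psi2 ->
    0 < t < 1 ->
    (forall a n, Psi a n = (t%:C)%C *: Psi1 a n + ((1 - t)%:C)%C *: Psi2 a n) ->
    Psi1 = Psi /\ Psi2 = Psi.

Definition locn (Phi : qstate) (n : nat) : lmx n := Phi 0%R n.

(* functional calculus for the real function ln (ln x = 0 for x <= 0, this   *)
(* value is irrelevant in the relative entropy below)                         *)
Definition logm n (X : lmx n) : lmx n :=
  invmx (spectralmx X) *m
  diag_mx (map_mx (fun z : C => ((ln (complex.Re z))%:C)%C) (spectral_diag X))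
  *m spectralmx X.

(* support of D1 below support of D2, i.e. range D1 is contained in range D2 *)
Definition supp_le n (D1 D2 : lmx n) : Prop := exists Y : lmx n, D1 = D2 *m Y.

Definition relent n (D1 D2 : lmx n) : \bar R :=
  if `[< supp_le D1 D2 >] then
    (complex.Re (\tr (D1 *m (logm D1 - logm D2))))%:E
  else +oo%E.

Definition relent_seq (Psi Phi : qstate) (n : nat) : \bar R :=
  ((n%:R)^-1%:E * relent (locn Psi n) (locn Phi n))%E.

Definition srate_exists (Psi Phi : qstate) : Prop :=
  exists l : \bar R, relent_seq Psi Phi @ \oo --> l.

Definition srate (Psi Phi : qstate) : \bar R := limn (relent_seq Psi Phi).

Definition srate_set (Omega : set qstate) (Phi : qstate) : \bar R :=
  ereal_inf [set srate Psi Phi | Psi in Omega].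

Definition elog (x : R) : \bar R := if x == 0 then -oo%E else (ln x)%:E.

Definition beta_n (eps : R) (n : nat) (Psi Phi : qstate) : \bar R :=
  ereal_inf [set elog (stval (locn Phi n) q) |
             q in [set q : lmx n | projection q /\ 1 - eps <= stval (locn Psi n) q]].

Definition betabar (eps : R) (Psi Phi : qstate) : \bar R :=
  limn_esup (fun n => ((n%:R)^-1%:E * beta_n eps n Psi Phi)%E).

Definition HP_condition (Psi Phi : qstate) : Prop :=
  srate_exists Psi Phi /\
  forall eps : R, 0 < eps < 1 -> (betabar eps Psi Phi <= - srate Psi Phi)%E.

Definition logrseq (Phi : qstate) (p : forall n, lmx n) (n : nat) : \bar R :=
  ((n%:R)^-1%:E * elog (stval (locn Phi n) (p n)))%E.

End QuantumSpinChain.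

(* Main.v *)
Require Import Defs.
From HB Require Import structures.
From mathcomp Require Import all_boot all_order all_algebra.
From mathcomp Require Import spectral complex.
From mathcomp Require Import boolp classical_sets reals ereal topology
  normedtype sequences exp.
From mathcomp Require Import ring lra.

Set Implicit Arguments.
Unset Strict Implicit.
Unset Printing Implicit Defensive.

Import Order.TTheory GRing.Theory Num.Theory.
Import numFieldNormedType.Exports.
Local Open Scope ring_scope.
Local Open Scope classical_set_scope.

(* Let s = s(Omega, Phi).  The point is to find one sequence of projections that works
   for uncountably many states Psi at once.

   For every l, the densities on l sites are dominated, up to a constant factor close to
   1, by the members of a countable family; mixing the block products of these over the
   first n members gives densities U_n such that every stationary Psi satisfies
   S(Psi^(n), W) <= n delta for some W <= n U_n.  Coarse-grain the spectrum of the density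
   of Phi^(n) into a fixed number of bins, pinch U_n by the spectral projections of the
   bins, and let p_n be the support of the positive part of
   pinch(U_n) - e^{n b} Phi^(n), with b slightly below s.  Then
   Phi(p_n) <= e^{- n b}.  For Psi in Omega the HP-condition provides q with Psi(q) close
   to 1 and Phi(q) <= e^{- n a}, b < a < s; with r = 1 - p_n this makes U_n(r q r), hence
   W(r q r), exponentially small.  Pairing the eigenbases of Psi^(n) and W as in the
   Nussbaum-Szkola distributions gives
     Psi(X) <= sqrt (M W(X (adj X))) + sqrt ((S(Psi^(n), W) + 1) / ln M)
   for every contraction X and M > 1; with X = r q it yields Psi(r) -> 0.  The same
   inequality with W = Phi^(n) and X a projection gives the lower bound on
   Phi(p~_n). *)

(** * Complex numbers and Hermitian matrices *)

Section ComplexParts.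
Local Open Scope complex_scope.
Context {R : realType}.
Local Notation C := R[i].
Local Notation Re := complex.Re.

Lemma ReD (x y : C) : Re (x + y) = Re x + Re y.
Proof. by case: x y => [a b] [c d]. Qed.

Lemma ReN (x : C) : Re (- x) = - Re x.
Proof. by case: x. Qed.

Lemma ReB (x y : C) : Re (x - y) = Re x - Re y.
Proof. by rewrite ReD ReN. Qed.

Lemma ReZ (a : R) (x : C) : Re (a%:C * x) = a * Re x.
Proof. by case: x => b c /=; rewrite mul0r subr0. Qed.

Lemma Re_sum (I : Type) (s : seq I) (P : pred I) (F : I -> C) :
  Re (\sum_(i <- s | P i) F i) = \sum_(i <- s | P i) Re (F i).
Proof. by elim/big_ind2: _ => // x1 x2 y1 y2 <- <-; rewrite ReD. Qed.

Lemma Re_ge0 (x : C) : 0 <= x -> 0 <= Re x.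
Proof. by rewrite lecE => /andP[]. Qed.

Lemma ge0_ReE (x : C) : 0 <= x -> x = (Re x)%:C.
Proof. by case: x => a b; rewrite lecE /= => /andP[/eqP-> _]. Qed.

Definition nsq (z : C) : R := Re z ^+ 2 + complex.Im z ^+ 2.

Lemma nsq_ge0 z : 0 <= nsq z.
Proof. by rewrite addr_ge0 ?sqr_ge0. Qed.

Lemma conjCE (z : C) : Num.conj z = Complex (Re z) (- complex.Im z).
Proof. by case: z. Qed.

Lemma mul_conjE (z : C) : z * Num.conj z = (nsq z)%:C.
Proof.
by rewrite conjCE; case: z => a b; apply/eqP; rewrite eq_complex /nsq /=; apply/andP; split; apply/eqP; ring.
Qed.

Lemma conj_RC (x : R) : Num.conj (x%:C : C) = x%:C.
Proof. by rewrite conjCE /= oppr0. Qed.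

Lemma nsq_conj z : nsq (Num.conj z) = nsq z.
Proof. by rewrite conjCE /nsq /= sqrrN. Qed.

(** The difference of the two sides is [t] times a sum of two squares. The weight [t] stays free, so
    that the inequality can first be summed and only then optimised in [le_sqrtM]. *)
Lemma ReM_le (x y : C) (t : R) : 0 < t -> 2 * Re (x * y) <= t * nsq x + nsq y / t.
Proof.
move=> t0; case: x y => a b [c d]; rewrite /nsq /=.
have -> : (c ^+ 2 + d ^+ 2) / t = ((c ^+ 2 + d ^+ 2) / t ^+ 2) * t.
  by field; rewrite gt_eqF.
rewrite -subr_ge0.
have -> : t * (a ^+ 2 + b ^+ 2) + (c ^+ 2 + d ^+ 2) / t ^+ 2 * t - 2 * (a * c - b * d)
  = t * ((a - c / t) ^+ 2 + (b + d / t) ^+ 2).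
  by field; rewrite gt_eqF.
by rewrite mulr_ge0 ?addr_ge0 ?sqr_ge0 // ltW.
Qed.

(** For positive [A] and [B] the optimal weight is [t = sqrt B / sqrt A]. If one of them is 0, a
    suitable [t] contradicts [x > 0]. *)
Lemma le_sqrtM (x A B : R) : 0 <= A -> 0 <= B ->
  (forall t, 0 < t -> 2 * x <= t * A + B / t) -> x <= Num.sqrt A * Num.sqrt B.
Proof.
move=> A0 B0 H.
have [x0|x0] := leP x 0; first by apply: (le_trans x0); rewrite mulr_ge0 ?sqrtr_ge0.
have [A1|] := eqVneq A 0.
  move: (H ((B + 1) / x)); rewrite A1 mulr0 add0r divr_gt0 // ?ltr_wpDl // => /(_ isT).
  have B1 : 0 < B + 1 by rewrite ltr_wpDl.
  rewrite invf_div mulrA ler_pdivlMr //; move=> H'; exfalso; nra.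
move=> An0.
have Ap : 0 < A by rewrite lt_neqAle A0 eq_sym andbT.
have [B1|Bn0] := eqVneq B 0.
  move: (H (x / A)); rewrite B1 mul0r addr0 divr_gt0 // => /(_ isT).
  rewrite divfK //; move=> H'; exfalso; lra.
have Bp : 0 < B by rewrite lt_neqAle B0 eq_sym andbT.
have a0 : 0 < Num.sqrt A by rewrite sqrtr_gt0.
have b0 : 0 < Num.sqrt B by rewrite sqrtr_gt0.
have := H (Num.sqrt B / Num.sqrt A); rewrite divr_gt0 // => /(_ isT).
rewrite -{2}(sqr_sqrtr A0) -{2}(sqr_sqrtr B0) => H'.
have E : Num.sqrt B / Num.sqrt A * Num.sqrt A ^+ 2 + Num.sqrt B ^+ 2 / (Num.sqrt B / Num.sqrt A) = 2 * (Num.sqrt A * Num.sqrt B).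
  by field; rewrite !gt_eqF.
by rewrite E in H'; lra.
Qed.

Lemma Re_sum_le_sqrt (I : finType) (P : pred I) (w : I -> R) (G Y : I -> C) (A B : R) :
  (forall i, P i -> 0 <= w i) ->
  \sum_(i | P i) w i * nsq (G i) <= A -> \sum_(i | P i) w i * nsq (Y i) <= B ->
  \sum_(i | P i) w i * Re (G i * Y i) <= Num.sqrt A * Num.sqrt B.
Proof.
move=> w0 hA hB.
have A0 : 0 <= A by apply: le_trans hA; apply: sumr_ge0 => i /w0 ?; rewrite mulr_ge0 ?nsq_ge0.
have B0 : 0 <= B by apply: le_trans hB; apply: sumr_ge0 => i /w0 ?; rewrite mulr_ge0 ?nsq_ge0.
apply: le_sqrtM => // t t0.
apply: (@le_trans _ _ (t * \sum_(i | P i) w i * nsq (G i) + (\sum_(i | P i) w i * nsq (Y i)) / t)); last first.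
  by rewrite lerD // ?ler_pM2l // ler_pM2r // invr_gt0.
rewrite !mulr_sumr mulr_suml -big_split /=; apply: ler_sum => i Pi.
have := ler_wpM2l (w0 i Pi) (ReM_le (G i) (Y i) t0); lra.
Qed.

End ComplexParts.

(** * Adjoints, unitary diagonalisation, functional calculus and positivity of complex matrices *)

Section Matrices.
Local Open Scope complex_scope.
Context {R : realType}.
Local Notation C := R[i].
Local Notation Re := complex.Re.

Lemma RCD (a b : R) : (a + b)%:C = a%:C + b%:C :> C. Proof. exact: rmorphD. Qed.
Lemma RCB (a b : R) : (a - b)%:C = a%:C - b%:C :> C. Proof. exact: rmorphB. Qed.
Lemma RCM (a b : R) : (a * b)%:C = a%:C * b%:C :> C. Proof. exact: rmorphM. Qed.
Lemma RC_sum (I : finType) (P : pred I) (F : I -> R) :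
  (\sum_(i | P i) F i)%:C = \sum_(i | P i) (F i)%:C :> C.
Proof. exact: rmorph_sum. Qed.

Definition ct m n (A : 'M[C]_(m, n)) : 'M[C]_(n, m) := (map_mx Num.conj A)^T.

Lemma ctE m n (A : 'M[C]_(m, n)) i j : ct A i j = Num.conj (A j i).
Proof. by rewrite !mxE. Qed.

Lemma ctK m n (A : 'M[C]_(m, n)) : ct (ct A) = A.
Proof. by apply/matrixP => i j; rewrite !ctE conjCK. Qed.

Lemma ctM m n p (A : 'M[C]_(m, n)) (B : 'M[C]_(n, p)) : ct (A *m B) = ct B *m ct A.
Proof. by rewrite /ct map_mxM trmx_mul. Qed.

Lemma ctD m n (A B : 'M[C]_(m, n)) : ct (A + B) = ct A + ct B.
Proof. by apply/matrixP => i j; rewrite !(mxE, ctE) rmorphD. Qed.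

Lemma ctN m n (A : 'M[C]_(m, n)) : ct (- A) = - ct A.
Proof. by apply/matrixP => i j; rewrite !(mxE, ctE) rmorphN. Qed.

Lemma ctB m n (A B : 'M[C]_(m, n)) : ct (A - B) = ct A - ct B.
Proof. by rewrite ctD ctN. Qed.

Lemma ctZ m n (a : R) (A : 'M[C]_(m, n)) : ct (a%:C *: A) = a%:C *: ct A.
Proof. by apply/matrixP => i j; rewrite !(mxE, ctE) rmorphM; congr (_ * _); apply: conj_RC. Qed.

Lemma ct1 n : ct (1%:M : 'M[C]_n) = 1%:M.
Proof. by rewrite /ct map_mx1 trmx1. Qed.

Lemma ct0 m n : ct (0 : 'M[C]_(m, n)) = 0.
Proof. by rewrite /ct map_mx0 trmx0. Qed.

Lemma ct_t m n (A : 'M[C]_(m, n)) : ct A = (A ^t Num.conj)%sesqui.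
Proof. by rewrite /ct map_trmx. Qed.

Lemma unitary_ct n (V : 'M[C]_n) : V *m ct V = 1%:M -> ct V *m V = 1%:M.
Proof. exact: mulmx1C. Qed.

Lemma mulmx_ctE m n (M : 'M[C]_(m, n)) i : (M *m ct M) i i = (\sum_j nsq (M i j))%:C.
Proof.
rewrite mxE RC_sum; apply: eq_bigr => j _; by rewrite ctE mul_conjE.
Qed.

Lemma ct_mulmxE m n (M : 'M[C]_(m, n)) i : (ct M *m M) i i = (\sum_j nsq (M j i))%:C.
Proof.
rewrite -[X in _ *m X]ctK mulmx_ctE; congr (_%:C).
by apply: eq_bigr => j _; rewrite ctE nsq_conj.
Qed.

Definition diagR n (h : 'I_n -> R) : 'M[C]_n := diag_mx (\row_i (h i)%:C).

Lemma diagRE n (h : 'I_n -> R) i j : diagR h i j = (h i)%:C *+ (i == j).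
Proof. by rewrite !mxE. Qed.

Lemma mul_diagR m n (h : 'I_m -> R) (A : 'M[C]_(m, n)) i j :
  (diagR h *m A) i j = (h i)%:C * A i j.
Proof. by rewrite mul_diag_mx !mxE. Qed.

Lemma mulr_diagR m n (h : 'I_n -> R) (A : 'M[C]_(m, n)) i j :
  (A *m diagR h) i j = A i j * (h j)%:C.
Proof. by rewrite mul_mx_diag !mxE. Qed.

Definition udiag n (V : 'M[C]_n) (h : 'I_n -> R) : 'M[C]_n := ct V *m diagR h *m V.

Lemma eq_udiag n (V : 'M[C]_n) h g : h =1 g -> udiag V h = udiag V g.
Proof. by move=> /funext ->. Qed.

Lemma ct_diagR n (h : 'I_n -> R) : ct (diagR h) = diagR h.
Proof.
apply/matrixP => i j; rewrite ctE !diagRE eq_sym; case: eqP => [->|_]; last by rewrite rmorph0.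
by rewrite mulr1n conj_RC.
Qed.

Lemma ct_udiag n (V : 'M[C]_n) h : ct (udiag V h) = udiag V h.
Proof. by rewrite /udiag !ctM ctK ct_diagR mulmxA. Qed.

Lemma udiagD n (V : 'M[C]_n) h g : udiag V h + udiag V g = udiag V (fun i => h i + g i).
Proof.
rewrite /udiag -mulmxDl -mulmxDr; congr (_ *m _ *m _).
by apply/matrixP => i j; rewrite mxE !diagRE -mulrnDl RCD.
Qed.

Lemma udiagZ n (V : 'M[C]_n) h (a : R) : a%:C *: udiag V h = udiag V (fun i => a * h i).
Proof.
rewrite /udiag scalemxAl scalemxAr; congr (_ *m _ *m _).
by apply/matrixP => i j; rewrite mxE !diagRE RCM mulrnAr.
Qed.

Lemma udiagM n (V : 'M[C]_n) h g : V *m ct V = 1%:M ->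
  udiag V h *m udiag V g = udiag V (fun i => h i * g i).
Proof.
move=> uV; rewrite /udiag -!mulmxA (mulmxA V) uV mul1mx; congr (_ *m _).
rewrite mulmxA; congr (_ *m _); apply/matrixP => i j; rewrite mul_diagR !diagRE.
by rewrite RCM mulrnAr.
Qed.

Lemma udiag1 n (V : 'M[C]_n) : V *m ct V = 1%:M -> udiag V (fun=> 1) = 1%:M.
Proof.
move=> /unitary_ct uV; rewrite /udiag (_ : diagR _ = 1%:M) ?mulmx1 //.
by apply/matrixP => i j; rewrite diagRE !mxE.
Qed.

Lemma udiag0 n (V : 'M[C]_n) : udiag V (fun=> 0) = 0.
Proof.
rewrite /udiag (_ : diagR _ = 0) ?mulmx0 ?mul0mx //.
by apply/matrixP => i j; rewrite diagRE !mxE mul0rn.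
Qed.

Lemma udiag_sum n (V : 'M[C]_n) (I : finType) (F : I -> 'I_n -> R) :
  \sum_k udiag V (F k) = udiag V (fun i => \sum_k F k i).
Proof.
rewrite /udiag -mulmx_suml -mulmx_sumr; congr (_ *m _ *m _).
apply/matrixP => i j; rewrite summxE diagRE RC_sum -sumrMnl.
by apply: eq_bigr => k _; rewrite diagRE.
Qed.

(** In the basis given by [V], commuting with [udiag V h] means that entry (i, j) of
    [V *m Z *m ct V] vanishes unless [h i = h j], and then [f (h i) = f (h j)] as well. *)
Lemma comm_udiag n (V Z : 'M[C]_n) h (f : R -> R) : V *m ct V = 1%:M ->
  Z *m udiag V h = udiag V h *m Z ->
  Z *m udiag V (f \o h) = udiag V (f \o h) *m Z.
Proof.
move=> uV; have uV' := unitary_ct uV.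
have key g : Z *m udiag V g = udiag V g *m Z <->
    (V *m Z *m ct V) *m diagR g = diagR g *m (V *m Z *m ct V).
  rewrite /udiag; split => E.
    have -> : V *m Z *m ct V *m diagR g = V *m (Z *m (ct V *m diagR g *m V)) *m ct V.
      by rewrite -!mulmxA uV mulmx1.
    by rewrite E !mulmxA uV mul1mx -!mulmxA.
  have -> : Z *m (ct V *m diagR g *m V) = ct V *m (V *m Z *m ct V *m diagR g) *m V.
    by rewrite !mulmxA uV' mul1mx.
  by rewrite E -!mulmxA uV' mulmx1.
move=> /key E; apply/key/matrixP => i j.
move/matrixP: E => /(_ i j); rewrite !mul_diagR !mulr_diagR.
set x := (V *m Z *m ct V) i j; have [hij|hij] := eqVneq (h i) (h j).
  by move=> _; rewrite /= hij mulrC.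
move=> /eqP; rewrite mulrC -subr_eq0 -mulrBl mulf_eq0 -RCB => /orP[|/eqP->].
  by rewrite eq_complex /= eqxx andbT subr_eq0 eq_sym (negbTE hij).
by rewrite mulr0 mul0r.
Qed.

(** The same entrywise argument, now for the intertwiner [V *m ct W]. It makes [fcalc] independent
    of the chosen diagonalisation. *)
Lemma udiag_uniq n (V W : 'M[C]_n) h g (f : R -> R) :
  V *m ct V = 1%:M -> W *m ct W = 1%:M -> udiag V h = udiag W g ->
  udiag V (f \o h) = udiag W (f \o g).
Proof.
move=> uV uW; have uV' := unitary_ct uV; have uW' := unitary_ct uW.
have key h' g' : udiag V h' = udiag W g' <->
    diagR h' *m (V *m ct W) = (V *m ct W) *m diagR g'.
  rewrite /udiag; split => E.
    have -> : diagR h' *m (V *m ct W) = V *m (ct V *m diagR h' *m V) *m ct W.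
      by rewrite !mulmxA uV mul1mx.
    by rewrite E -!mulmxA uW mulmx1.
  have -> : ct V *m diagR h' *m V = ct V *m (diagR h' *m (V *m ct W)) *m W.
    by rewrite -!mulmxA uW' mulmx1.
  by rewrite E !mulmxA uV' mul1mx.
move=> /key E; apply/key/matrixP => i j.
move/matrixP: E => /(_ i j); rewrite !mul_diagR !mulr_diagR.
set x := (V *m ct W) i j; have [hij|hij] := eqVneq (h i) (g j).
  by move=> _; rewrite /= hij mulrC.
move=> /eqP; rewrite -subr_eq0 (mulrC x) -mulrBl mulf_eq0 -RCB => /orP[|/eqP->].
  by rewrite eq_complex /= eqxx andbT subr_eq0 (negbTE hij).
by rewrite mulr0 mul0r.
Qed.

Definition specval n (X : 'M[C]_n) (i : 'I_n) : R := Re (spectral_diag X 0 i).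

Lemma spectral_unitary n (X : 'M[C]_n) : spectralmx X *m ct (spectralmx X) = 1%:M.
Proof. by rewrite ct_t; apply/unitarymxP/spectral_unitarymx. Qed.

Lemma invmx_spectral n (X : 'M[C]_n) : invmx (spectralmx X) = ct (spectralmx X).
Proof. by rewrite ct_t; apply/invmx_unitary/spectral_unitarymx. Qed.

Lemma spectralE n (X : 'M[C]_n) : ct X = X -> X = udiag (spectralmx X) (specval X).
Proof.
move=> hX; have hH : X \is hermsymmx.
  by apply/is_hermitianmxP; rewrite expr0 scale1r -ct_t hX.
have /orthomx_spectralP := hermitian_normalmx hH.
rewrite invmx_spectral => {1}->; rewrite /udiag /diagR.
congr (_ *m diag_mx _ *m _); apply/rowP => i; rewrite mxE /specval RRe_real //.
by have /mxOverP/(_ 0 i) := hermitian_spectral_diag_real hH.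
Qed.

Definition fcalc n (f : R -> R) (X : 'M[C]_n) : 'M[C]_n :=
  udiag (spectralmx X) (f \o specval X).

Lemma fcalc_udiag n (V : 'M[C]_n) h f : V *m ct V = 1%:M ->
  fcalc f (udiag V h) = udiag V (f \o h).
Proof.
move=> uV; apply: udiag_uniq => //; first exact: spectral_unitary.
by rewrite -spectralE // ct_udiag.
Qed.

Lemma comm_fcalc n (X Z : 'M[C]_n) f : ct X = X -> Z *m X = X *m Z ->
  Z *m fcalc f X = fcalc f X *m Z.
Proof.
move=> hX; rewrite {1 2}(spectralE hX) => E.
by apply: comm_udiag => //; apply: spectral_unitary.
Qed.

(** Same body as [psd], but for every matrix size, so that facts pass between the two by
    conversion. *)
Definition Psd n (X : 'M[C]_n) : Prop :=
  forall v : 'cV[C]_n, 0 <= ((map_mx Num.conj v)^T *m X *m v) 0 0.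

Lemma PsdP n (X : 'M[C]_n) (v : 'cV[C]_n) : Psd X -> 0 <= (ct v *m X *m v) 0 0.
Proof. exact. Qed.

Lemma Psd_cong n m (X : 'M[C]_n) (A : 'M[C]_(n, m)) : Psd X -> Psd (ct A *m X *m A).
Proof. by move=> pX v; have := PsdP (A *m v) pX; rewrite ctM !mulmxA. Qed.

Lemma Psd_conj_ct n m (X : 'M[C]_n) (A : 'M[C]_(m, n)) : Psd X -> Psd (A *m X *m ct A).
Proof. by move=> pX; rewrite -{1}(ctK A); apply: Psd_cong. Qed.

Lemma PsdD n (X Y : 'M[C]_n) : Psd X -> Psd Y -> Psd (X + Y).
Proof.
by move=> pX pY v; rewrite mulmxDr mulmxDl mxE addr_ge0 //.
Qed.

Lemma Psd0 n : Psd (0 : 'M[C]_n).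
Proof. by move=> v; rewrite mulmx0 mul0mx mxE. Qed.

Lemma PsdZ n (a : R) (X : 'M[C]_n) : 0 <= a -> Psd X -> Psd (a%:C *: X).
Proof.
move=> a0 pX v; rewrite -scalemxAr -scalemxAl mxE mulr_ge0 ?ler0c //.
Qed.

Lemma Psd_sum n (I : finType) (P : pred I) (F : I -> 'M[C]_n) :
  (forall i, P i -> Psd (F i)) -> Psd (\sum_(i | P i) F i).
Proof. by move=> H; elim/big_ind: _; [apply: Psd0|apply: PsdD|]. Qed.

Lemma Psd_diagR n (h : 'I_n -> R) : (forall i, 0 <= h i) -> Psd (diagR h).
Proof.
move=> h0 v; rewrite -mulmxA mxE sumr_ge0 // => i _.
rewrite mul_diagR ctE mulrCA mulr_ge0 ?ler0c // mulrC mul_conjE ler0c.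
exact: nsq_ge0.
Qed.

Lemma Psd_udiag n (V : 'M[C]_n) h : (forall i, 0 <= h i) -> Psd (udiag V h).
Proof. by move=> h0; apply/Psd_cong/Psd_diagR. Qed.

Lemma Psd1 n : Psd (1%:M : 'M[C]_n).
Proof.
rewrite -(udiag1 (V := 1%:M)) ?ct1 ?mulmx1 //.
by apply: Psd_udiag => i; apply: ler01.
Qed.

Lemma Psd_ctM n m (A : 'M[C]_(m, n)) : Psd (ct A *m A).
Proof. by rewrite -[ct A]mulmx1; apply/Psd_cong/Psd1. Qed.

Lemma Psd_diag_ge0 n (X : 'M[C]_n) i : Psd X -> 0 <= X i i.
Proof.
move=> /(PsdP (delta_mx i 0)); rewrite -mulmxA mxE (bigD1 i) //= big1 ?addr0.
  rewrite ctE mxE !eqxx rmorph1 mul1r mxE (bigD1 i) //= big1 ?addr0.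
    by rewrite mxE !eqxx mulr1.
  by move=> j /negbTE jn; rewrite mxE jn mulr0.
by move=> j /negbTE jn; rewrite ctE mxE jn rmorph0 mul0r.
Qed.

Lemma udiag_conj n (V : 'M[C]_n) h : V *m ct V = 1%:M ->
  V *m udiag V h *m ct V = diagR h.
Proof. by move=> uV; rewrite /udiag !mulmxA uV mul1mx -mulmxA uV mulmx1. Qed.

Lemma Psd_udiag_ge0 n (V : 'M[C]_n) h i : V *m ct V = 1%:M ->
  Psd (udiag V h) -> 0 <= h i.
Proof.
move=> uV /(Psd_conj_ct V) /(Psd_diag_ge0 i); rewrite udiag_conj //.
by rewrite diagRE eqxx mulr1n ler0c.
Qed.

(** Polarisation: the values at sums of basis vectors, with and without a factor i, determine all
    the entries. *)
Lemma qf_eq0 n (Y : 'M[C]_n) :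
  (forall v : 'cV[C]_n, (ct v *m Y *m v) 0 0 = 0) -> Y = 0.
Proof.
move=> H.
have qd i j : (ct (delta_mx i 0 : 'cV[C]_n) *m Y *m (delta_mx j 0 : 'cV[C]_n)) 0 0 = Y i j.
  rewrite -mulmxA mxE (bigD1 i) //= big1 ?addr0.
    rewrite ctE mxE !eqxx rmorph1 mul1r mxE (bigD1 j) //= big1 ?addr0.
      by rewrite mxE !eqxx mulr1.
    by move=> l /negbTE jn; rewrite mxE jn mulr0.
  by move=> l /negbTE jn; rewrite ctE mxE jn rmorph0 mul0r.
have key (u v : 'cV[C]_n) : (ct u *m Y *m v) 0 0 + (ct v *m Y *m u) 0 0 = 0.
  have := H (u + v); rewrite ctD !mulmxDl !mulmxDr mxE [X in X + _]mxE [X in _ + X]mxE.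
  by rewrite (H u) (H v) addr0 add0r.
apply/matrixP => i j; rewrite mxE.
have k1 := key (delta_mx i 0) (delta_mx j 0); rewrite !qd in k1.
have ci : Num.conj ('i : C) = - 'i.
  by rewrite conjCE /=; apply/eqP; rewrite eq_complex /= oppr0 !eqxx.
have := key (delta_mx i 0) ('i *: delta_mx j 0).
have -> : ct ('i *: delta_mx j 0 : 'cV[C]_n) = - 'i *: ct (delta_mx j 0 : 'cV[C]_n).
  by apply/matrixP => a b; rewrite !(mxE, ctE) -ci; apply: rmorphM.
rewrite -scalemxAr -!scalemxAl [X in X + _]mxE [X in _ + X]mxE !qd mulNr -mulrBr => /eqP; rewrite mulf_eq0.
have /negbTE -> : ('i : C) != 0 by rewrite eq_complex /= oner_eq0 andbF.
rewrite /= subr_eq0 => /eqP E; move: k1; rewrite -E -mulr2n => /eqP.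
by rewrite mulrn_eq0 /= => /eqP.
Qed.

(** The quadratic form of [X] takes real values, so that of [X - ct X] vanishes identically. *)
Lemma Psd_ct n (X : 'M[C]_n) : Psd X -> ct X = X.
Proof.
move=> pX; apply/eqP; rewrite -subr_eq0; apply/eqP/qf_eq0 => v.
rewrite mulmxBr mulmxBl mxE [X in _ + X]mxE.
have -> : ct v *m ct X *m v = ct (ct v *m X *m v) by rewrite !ctM ctK mulmxA.
by rewrite ctE (ge0_ReE (PsdP v pX)) conj_RC subrr.
Qed.

Lemma Psd_spectral n (X : 'M[C]_n) : Psd X -> exists V h,
  [/\ V *m ct V = 1%:M, (forall i, 0 <= h i) & X = udiag V h].
Proof.
move=> pX; exists (spectralmx X), (specval X).
have E := spectralE (Psd_ct pX); split=> //; first exact: spectral_unitary.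
by move=> i; apply: (@Psd_udiag_ge0 _ (spectralmx X)); rewrite -?E //; apply: spectral_unitary.
Qed.

Definition ev n (D X : 'M[C]_n) : R := Re (\tr (D *m X)).

Lemma evC n (D X : 'M[C]_n) : ev D X = ev X D.
Proof. by rewrite /ev mxtrace_mulC. Qed.

Lemma evDr n (D X Y : 'M[C]_n) : ev D (X + Y) = ev D X + ev D Y.
Proof. by rewrite /ev mulmxDr mxtraceD ReD. Qed.

Lemma evBr n (D X Y : 'M[C]_n) : ev D (X - Y) = ev D X - ev D Y.
Proof. by rewrite /ev mulmxBr raddfB ReB. Qed.

Lemma evZr n (D X : 'M[C]_n) a : ev D (a%:C *: X) = a * ev D X.
Proof. by rewrite /ev -scalemxAr mxtraceZ ReZ. Qed.

Lemma ev_sumr n (D : 'M[C]_n) (I : finType) (P : pred I) (F : I -> 'M[C]_n) :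
  ev D (\sum_(i | P i) F i) = \sum_(i | P i) ev D (F i).
Proof. by elim/big_rec2: _ => [|i x y _ <-]; rewrite ?evDr // /ev mulmx0 mxtrace0. Qed.

Lemma ev_udiag n (V : 'M[C]_n) h X :
  ev (udiag V h) X = \sum_i h i * Re ((V *m X *m ct V) i i).
Proof.
rewrite /ev /udiag -!mulmxA mxtrace_mulC -!mulmxA /mxtrace Re_sum.
by apply: eq_bigr => i _; rewrite mul_diagR ReZ !mulmxA.
Qed.

Lemma ev_ge0 n (D X : 'M[C]_n) : Psd D -> Psd X -> 0 <= ev D X.
Proof.
move=> /Psd_spectral[V [h [uV h0 ->]]] pX; rewrite ev_udiag sumr_ge0 // => i _.
by rewrite mulr_ge0 // Re_ge0 // Psd_diag_ge0 //; apply: Psd_conj_ct.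
Qed.

Lemma ev_le n (D X Y : 'M[C]_n) : Psd D -> Psd (Y - X) -> ev D X <= ev D Y.
Proof. by move=> pD pXY; rewrite -subr_ge0 -evBr ev_ge0. Qed.

(** In an eigenbasis of [D] the expectation is a double sum over matrix entries weighted by the
    eigenvalues, to which the weighted Cauchy-Schwarz inequality applies. *)
Lemma ev_CS n (D A B : 'M[C]_n) : Psd D ->
  ev D (A *m B) <= Num.sqrt (ev D (A *m ct A)) * Num.sqrt (ev D (ct B *m B)).
Proof.
move=> /Psd_spectral[V [h [uV h0 ->]]]; have uV' := unitary_ct uV.
rewrite !ev_udiag.
have -> : \sum_i h i * Re ((V *m (A *m B) *m ct V) i i) =
   \sum_(p : 'I_n * 'I_n) h p.1 * Re ((V *m A) p.1 p.2 * (B *m ct V) p.2 p.1).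
  rewrite -(pair_bigA _ (fun i j => h i * Re ((V *m A) i j * (B *m ct V) j i))) /=.
  by apply: eq_bigr => i _; rewrite -mulr_sumr !mulmxA -mulmxA mxE Re_sum.
apply: Re_sum_le_sqrt => [[i j] _||] /=; first exact: h0.
  rewrite -(pair_bigA _ (fun i j => h i * nsq ((V *m A) i j))) /=.
  apply: ler_sum => i _; rewrite -mulr_sumr.
  have -> : V *m (A *m ct A) *m ct V = (V *m A) *m ct (V *m A) by rewrite ctM !mulmxA.
  by rewrite mulmx_ctE.
rewrite -(pair_bigA _ (fun i j => h i * nsq ((B *m ct V) j i))) /=.
apply: ler_sum => i _; rewrite -mulr_sumr.
have -> : V *m (ct B *m B) *m ct V = ct (B *m ct V) *m (B *m ct V) by rewrite ctM ctK !mulmxA.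
by rewrite ct_mulmxE.
Qed.

End Matrices.

(** * Relative entropy and the Nussbaum-Szkola bound *)

Section RelativeEntropy.
Local Open Scope complex_scope.
Context {R : realType}.
Local Notation C := R[i].
Local Notation Re := complex.Re.

(** The finite branch of [relent]. As [ln 0 = 0] here, it is the relative entropy only if the
    support of [D] lies below that of [Q]; that condition is carried separately. *)
Definition qrel n (D Q : 'M[C]_n) : R := ev D (fcalc (@ln R) D - fcalc (@ln R) Q).

Lemma ev_udiag_diag n (V : 'M[C]_n) (a b : 'I_n -> R) : V *m ct V = 1%:M ->
  ev (udiag V a) (udiag V b) = \sum_i a i * b i.
Proof.
move=> uV; rewrite ev_udiag; apply: eq_bigr => i _.
by rewrite udiag_conj // diagRE eqxx.
Qed.

Lemma ev_udiag2 n (V W : 'M[C]_n) (a b : 'I_n -> R) :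
  ev (udiag V a) (udiag W b) = \sum_i \sum_j a i * nsq ((V *m ct W) i j) * b j.
Proof.
rewrite ev_udiag; apply: eq_bigr => i _.
have -> : V *m udiag W b *m ct V = (V *m ct W) *m (diagR b *m ct (V *m ct W)).
  by rewrite /udiag ctM ctK !mulmxA.
set G := V *m ct W; rewrite mxE Re_sum mulr_sumr; apply: eq_bigr => j _.
by rewrite mul_diagR ctE mulrCA mul_conjE -RCM /= -mulrA [b j * _]mulrC.
Qed.

Lemma sum_nsq_row n (V W : 'M[C]_n) i : V *m ct V = 1%:M -> W *m ct W = 1%:M ->
  \sum_j nsq ((V *m ct W) i j) = 1.
Proof.
move=> uV /unitary_ct uW.
have := mulmx_ctE (V *m ct W) i; rewrite ctM ctK mulmxA -(mulmxA V) uW mulmx1 uV.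
by rewrite mxE eqxx => -[].
Qed.

Lemma nsq_flip n (V W : 'M[C]_n) i j : nsq ((V *m ct W) i j) = nsq ((W *m ct V) j i).
Proof. by rewrite -nsq_conj -ctE ctM ctK. Qed.

(** The rows of |G_ij|^2 sum to 1, so the term in [ln (l i)] can be spread over [j]. The result is
    the classical relative entropy of the Nussbaum-Szkola distributions, whose common factor
    |G_ij|^2 cancels in the logarithm. *)
Lemma qrel_basis n (V W : 'M[C]_n) (l m : 'I_n -> R) :
  V *m ct V = 1%:M -> W *m ct W = 1%:M ->
  qrel (udiag V l) (udiag W m) =
  \sum_i \sum_j l i * nsq ((V *m ct W) i j) * (ln (l i) - ln (m j)).
Proof.
move=> uV uW; rewrite /qrel !fcalc_udiag // evBr ev_udiag_diag // ev_udiag2 -sumrB.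
apply: eq_bigr => i _; rewrite -[l i * _]mulr1 -(sum_nsq_row i uV uW) mulr_sumr -sumrB.
by apply: eq_bigr => j _ /=; ring.
Qed.

(** Absolute continuity of the first distribution: these nonnegative numbers add up over [i] to the
    diagonal entry [j] of [W *m udiag V l *m ct W], which is 0 when [m j = 0]. *)
Lemma supp_vanish n (V W Y : 'M[C]_n) (l m : 'I_n -> R) : W *m ct W = 1%:M ->
  (forall i, 0 <= l i) -> udiag V l = udiag W m *m Y ->
  forall i j, m j = 0 -> l i * nsq ((V *m ct W) i j) = 0.
Proof.
move=> uW l0 E i j mj.
have : Re ((W *m udiag V l *m ct W) j j) = 0.
  by rewrite E /udiag !mulmxA uW mul1mx -!mulmxA mul_diagR mj mul0r.
have -> : W *m udiag V l *m ct W = (W *m ct V) *m (diagR l *m ct (W *m ct V)).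
  by rewrite /udiag ctM ctK !mulmxA.
rewrite mxE Re_sum.
under eq_bigr => k _.
  rewrite mul_diagR ctE mulrCA mul_conjE -RCM /= -nsq_flip.
  over.
move=> /psumr_eq0P; apply => // k _; by rewrite mulr_ge0 ?nsq_ge0.
Qed.

Lemma mul_ln_sub_ge (l m : R) : 0 < l -> 0 < m -> 0 <= l * (ln l - ln m) + m.
Proof.
move=> l0 m0.
have /ltW := @ln_sublinear R _ (divr_gt0 m0 l0).
rewrite lnM ?posrE ?invr_gt0 // lnV ?posrE // ler_pdivlMr //; lra.
Qed.

(** Adding the mass of [m] makes every summand nonnegative by [mul_ln_sub_ge], and where
    [l i > M * m j] the logarithm exceeds [ln M]. Summed up, this is a Markov bound on the pairs of
    large likelihood ratio. *)
Lemma qrel_term n (V W Y : 'M[C]_n) (l m : 'I_n -> R) (M : R) : 1 < M ->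
  W *m ct W = 1%:M -> (forall i, 0 <= l i) -> (forall i, 0 <= m i) ->
  udiag V l = udiag W m *m Y -> forall i j,
  (if l i <= M * m j then 0 else ln M * (l i * nsq ((V *m ct W) i j))) <=
  l i * nsq ((V *m ct W) i j) * (ln (l i) - ln (m j)) + m j * nsq ((V *m ct W) i j).
Proof.
move=> M1 uW l0 m0 E i j; have := supp_vanish uW l0 E i (j := j).
set w := nsq _; have w0 : 0 <= w by apply: nsq_ge0.
have M0 : 0 < M by lra.
have lnM0 : 0 < ln M by rewrite ln_gt0.
have [->|li] := eqVneq (l i) 0.
  move=> _; rewrite !mul0r mulr0 if_same add0r; exact: mulr_ge0.
have [->|wn] := eqVneq w 0.
  by move=> _; rewrite !mulr0 mul0r addr0 if_same.
have lp : 0 < l i by rewrite lt_neqAle eq_sym li l0.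
have wp : 0 < w by rewrite lt_neqAle eq_sym wn w0.
move=> H; have mp : 0 < m j.
  rewrite lt_neqAle eq_sym m0 andbT; apply/eqP => /H /eqP.
  by rewrite gt_eqF // mulr_gt0.
have K := mul_ln_sub_ge lp mp.
case: ifP => [_|/negbT]; first by have := mulr_ge0 w0 K; lra.
rewrite -ltNge => Ml.
have : ln M + ln (m j) <= ln (l i).
  rewrite -lnM ?posrE //; apply: ltW; rewrite ltr_ln ?posrE //; exact: mulr_gt0.
have : 0 < l i * w by apply: mulr_gt0.
have : 0 < m j * w by apply: mulr_gt0.
move=> a b c; nra.
Qed.

(* Nussbaum-Szkola: the pair of distributions l_i |G_ij|^2, m_j |G_ij|^2
   reduces the comparison of two noncommuting densities to a classical one. *)
Lemma ev_le_rel n (D Q X : 'M[C]_n) (M : R) :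
  Psd D -> ev D 1%:M = 1 -> Psd Q -> (exists Y, D = Q *m Y) ->
  ev D (ct X *m X) <= 1 -> 1 < M ->
  ev D X <= Num.sqrt (M * ev Q (X *m ct X)) + Num.sqrt ((qrel D Q + ev Q 1%:M) / ln M).
Proof.
move=> /Psd_spectral[V [l [uV l0 ->]]] D1 /Psd_spectral[W [m [uW m0 ->]]] [Z E] X1 M1.
have uV' := unitary_ct uV; have uW' := unitary_ct uW.
have lnM0 : 0 < ln M by rewrite ln_gt0.
have M0 : 0 < M by lra.
have l1 : \sum_i l i = 1.
  rewrite -[RHS]D1 -(udiag1 uV) ev_udiag_diag //; by apply: eq_bigr => i _; rewrite mulr1.
have m1 : ev (udiag W m) 1%:M = \sum_i m i.
  rewrite -(udiag1 uW) ev_udiag_diag //; by apply: eq_bigr => i _; rewrite mulr1.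
have K := qrel_term M1 uW l0 m0 E.
rewrite qrel_basis // m1.
set G := V *m ct W; pose Y := W *m X *m ct V.
rewrite -/G in K.
have GY : V *m X *m ct V = G *m Y.
  by rewrite /G /Y !mulmxA -(mulmxA V (ct W)) uW' mulmx1.
have Wrow i : \sum_j nsq (G i j) = 1 by apply: sum_nsq_row.
have Wcol j : \sum_i nsq (G i j) = 1.
  by under eq_bigr => i _ do rewrite nsq_flip; apply: sum_nsq_row.
have YlE : \sum_(p : 'I_n * 'I_n) l p.1 * nsq (Y p.2 p.1) = ev (udiag V l) (ct X *m X).
  rewrite -(pair_bigA _ (fun i j => l i * nsq (Y j i))) /= ev_udiag.
  apply: eq_bigr => i _; rewrite -mulr_sumr.
  have -> : V *m (ct X *m X) *m ct V = ct Y *m Y.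
    by rewrite /Y !ctM ctK !mulmxA -(mulmxA (V *m ct X) (ct W)) uW' mulmx1.
  by rewrite ct_mulmxE.
have YmE : \sum_(p : 'I_n * 'I_n) m p.2 * nsq (Y p.2 p.1) = ev (udiag W m) (X *m ct X).
  rewrite -(pair_bigA _ (fun i j => m j * nsq (Y j i))) /= ev_udiag exchange_big.
  apply: eq_bigr => i _; rewrite -mulr_sumr.
  have -> : W *m (X *m ct X) *m ct W = Y *m ct Y.
    by rewrite /Y !ctM ctK !mulmxA -(mulmxA (W *m X) (ct V)) uV' mulmx1.
  by rewrite mulmx_ctE.
have -> : ev (udiag V l) X = \sum_(p : 'I_n * 'I_n) l p.1 * Re (G p.1 p.2 * Y p.2 p.1).
  rewrite -(pair_bigA _ (fun i j => l i * Re (G i j * Y j i))) /= ev_udiag.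
  by apply: eq_bigr => i _; rewrite -mulr_sumr GY mxE Re_sum.
(* Split at likelihood ratio [M]. On the pairs below it, Cauchy-Schwarz is applied with total mass
   at most 1 for [G], and [l] is replaced by [M * m] in the factor with [Y]. *)
rewrite (bigID (fun p : 'I_n * 'I_n => l p.1 <= M * m p.2)) /=; apply: lerD.
  rewrite -[X in _ <= X]mul1r -[X in _ <= X * _]sqrtr1.
  apply: Re_sum_le_sqrt => [p _||]; first exact: l0.
    rewrite -l1 -[X in _ <= X](_ : \sum_(p : 'I_n * 'I_n) l p.1 * nsq (G p.1 p.2) = _).
      rewrite [X in _ <= X](bigID (fun p : 'I_n * 'I_n => l p.1 <= M * m p.2)) /= lerDl.
      by apply: sumr_ge0 => p _; rewrite mulr_ge0 ?nsq_ge0.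
    rewrite -(pair_bigA _ (fun i j => l i * nsq (G i j))) /=; apply: eq_bigr => i _.
    by rewrite -mulr_sumr Wrow mulr1.
  rewrite -YmE mulr_sumr.
  rewrite [X in _ <= X](bigID (fun p : 'I_n * 'I_n => l p.1 <= M * m p.2)) /=.
  rewrite -[X in X <= _]addr0; apply: lerD.
    by apply: ler_sum => p lp; rewrite mulrA ler_wpM2r ?nsq_ge0.
  by apply: sumr_ge0 => p _; rewrite !mulr_ge0 ?nsq_ge0 // ltW.
(* On the remaining pairs [K] bounds the mass of [G], and the factor with [Y] is at most 1 by the
   assumption on [ct X *m X]. *)
rewrite -[X in _ <= X]mulr1 -[X in _ <= _ * X]sqrtr1.
apply: Re_sum_le_sqrt => [p _||]; first exact: l0.
  rewrite ler_pdivlMr // mulrC mulr_sumr.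
  have -> : \sum_i m i = \sum_i \sum_j m j * nsq (G i j).
    rewrite exchange_big /=; apply: eq_bigr => j _; by rewrite -mulr_sumr Wcol mulr1.
  rewrite -big_split /=.
  under [X in _ <= X]eq_bigr => i _ do rewrite -big_split /=.
  rewrite pair_big /= big_mkcond /=.
  by apply: ler_sum => p _; have := K p.1 p.2; case: ifP.
apply: le_trans X1; rewrite -YlE.
rewrite [X in _ <= X](bigID (fun p : 'I_n * 'I_n => l p.1 <= M * m p.2)) /= lerDr.
by apply: sumr_ge0 => p _; rewrite mulr_ge0 ?nsq_ge0.
Qed.

End RelativeEntropy.

(** * Pinching and the universal test *)

Section Pinching.
Local Open Scope complex_scope.
Context {R : realType}.
Local Notation C := R[i].
Local Notation Re := complex.Re.

(** Take [k <= K] with [x <= th ^+ k] such that either [th ^+ k.+1 <= x], which costs the factor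
    [th^-1], or [k = K], which costs the additive term [th ^+ K]. *)
Lemma geometric_bins (th : R) (K : nat) : 0 < th < 1 ->
  exists kf : R -> 'I_K.+1, forall x, 0 <= x <= 1 ->
    x <= th ^+ kf x /\ th ^+ kf x <= th^-1 * x + th ^+ K.
Proof.
move=> /andP[th0 th1].
suff H (x : R) : 0 <= x <= 1 -> exists k, [/\ (k <= K)%N, x <= th ^+ k & k = K \/ th ^+ k.+1 <= x].
  suff /choice[f fP] : forall x, exists k : 'I_K.+1, 0 <= x <= 1 ->
    x <= th ^+ k /\ th ^+ k <= th^-1 * x + th ^+ K by exists f.
  move=> {}x.
  have [x01|] := boolP (0 <= x <= 1); last by exists ord0.
  have [k [kK xk H']] := H x x01.
  exists (Ordinal (kK : (k < K.+1)%N)) => _; split => //=.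
  case/andP: x01 => x0 _.
  case: H' => [->|H']; first by rewrite lerDr mulr_ge0 // invr_ge0 ltW.
  rewrite -[X in X <= _]addr0; apply: lerD; last by rewrite exprn_ge0 // ltW.
  by rewrite [th^-1 * x]mulrC ler_pdivlMr // -exprSr.
move=> /andP[x0 x1]; elim: K => [|K [k [kK xk [E|H]]]].
- by exists 0%N; split => //; left.
- have [xl|xl] := leP x (th ^+ K.+1); first by exists K.+1; split => //; left.
  by exists k; split => //; [apply: leqW | right; rewrite E ltW].
- by exists k; split => //; [apply: leqW | right].
Qed.

Definition pinch n K (E : 'I_K.+1 -> 'M[C]_n) (U : 'M[C]_n) := \sum_k E k *m U *m E k.

Section PinchTheory.
Variables (n K : nat) (E : 'I_K.+1 -> 'M[C]_n) (U : 'M[C]_n).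
Hypothesis Ect : forall k, ct (E k) = E k.
Hypothesis E1 : \sum_k E k = 1%:M.
Hypothesis EE : forall k l, E k *m E l = if k == l then E k else 0.
Hypothesis pU : Psd U.

Lemma Psd_pinch : Psd (pinch E U).
Proof. by apply: Psd_sum => k _; rewrite -{1}Ect; apply: Psd_cong. Qed.

Lemma pinch_E k : E k *m pinch E U = E k *m U *m E k.
Proof.
rewrite /pinch mulmx_sumr (bigD1 k) //= big1 ?addr0 => [|l lk].
  by rewrite !mulmxA EE eqxx.
by rewrite !mulmxA EE eq_sym (negbTE lk) !mul0mx.
Qed.

Lemma E_pinch k : pinch E U *m E k = E k *m U *m E k.
Proof.
rewrite /pinch mulmx_suml (bigD1 k) //= big1 ?addr0 => [|l lk].
  by rewrite -!mulmxA EE eqxx.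
by rewrite -!mulmxA EE (negbTE lk) !mulmx0.
Qed.

Lemma ev_pinch1 : ev (pinch E U) 1%:M = ev U 1%:M.
Proof.
rewrite evC ev_sumr -[in RHS]E1 ev_sumr; apply: eq_bigr => k _.
by rewrite /ev mul1mx mxtrace_mulC mulmxA EE eqxx mxtrace_mulC.
Qed.

(* 2 (K.+1 pinch U - U) is the sum over k, l of (E_k - E_l) U (E_k - E_l). *)
Lemma pinching_ineq : Psd (K.+1%:R%:C *: pinch E U - U).
Proof.
have cross : \sum_k \sum_l E k *m U *m E l = U.
  under eq_bigr => k _ do rewrite -mulmx_sumr E1 mulmx1.
  by rewrite -mulmx_suml E1 mul1mx.
have S : \sum_k \sum_l (E k - E l) *m U *m (E k - E l) =
    (2 : R)%:C *: (K.+1%:R%:C *: pinch E U - U).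
  have nat_C (m : nat) : (m%:R : R)%:C = m%:R :> C by rewrite rmorph_nat.
  transitivity (\sum_(k < K.+1) \sum_(l < K.+1) (E k *m U *m E k + E l *m U *m E l)
      - (\sum_(k < K.+1) \sum_(l < K.+1) E k *m U *m E l
         + \sum_(k < K.+1) \sum_(l < K.+1) E l *m U *m E k)).
    rewrite -big_split -sumrB; apply: eq_bigr => k _.
    rewrite -big_split -sumrB; apply: eq_bigr => l _ /=.
    rewrite mulmxBr !mulmxBl.
    set a := E k *m U *m E k; set b := E l *m U *m E k.
    set c := E k *m U *m E l; set d := E l *m U *m E l.
    rewrite !opprB addrACA opprD; congr (_ + _).
    by rewrite addrC.
  rewrite [X in _ - (_ + X)]exchange_big /= cross.
  under eq_bigr => k _ do rewrite big_split /=.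
  rewrite big_split /= -/(pinch E U).
  under [X in X + _ - _]eq_bigr => k _ do rewrite sumr_const card_ord.
  rewrite sumr_const card_ord !sumrMnl -/(pinch E U) !nat_C !scaler_nat.
  by rewrite mulrnBl !mulr2n.
have h2 : (2^-1 : R)%:C * (2 : R)%:C = 1 by rewrite -RCM mulVf.
rewrite -[X in Psd X]scale1r -h2 -scalerA -S.
apply: PsdZ; first by rewrite invr_ge0.
apply: Psd_sum => k _; apply: Psd_sum => l _.
have {1}-> : E k - E l = ct (E k - E l) by rewrite ctB !Ect.
exact: Psd_cong.
Qed.

End PinchTheory.

(** Projections of the full matrix algebra; membership in the local algebra is treated separately,
    through commutation with the [blabel] matrices. *)
Definition is_proj n (p : 'M[C]_n) := ct p = p /\ p *m p = p.

Lemma is_proj_psd n (p : 'M[C]_n) : is_proj p -> Psd p.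
Proof. by case=> h e; rewrite -e -{1}h; apply: Psd_ctM. Qed.

Lemma is_projC n (p : 'M[C]_n) : is_proj p -> is_proj (1%:M - p).
Proof.
case=> h e; split; first by rewrite ctB ct1 h.
by rewrite mulmxBr !mulmxBl !mulmx1 !mul1mx e subrr subr0.
Qed.

Definition posproj n (H : 'M[C]_n) : 'M[C]_n := fcalc (fun x : R => (0 < x)%R%:R) H.

Lemma posproj_proj n (H : 'M[C]_n) : is_proj (posproj H).
Proof.
have uP := spectral_unitary H; split; first exact: ct_udiag.
rewrite /posproj /fcalc udiagM //; apply: eq_udiag => i /=.
by case: (0 < _); rewrite ?mulr1 ?mulr0.
Qed.

Lemma posproj_ge0 n (H : 'M[C]_n) : ct H = H -> 0 <= ev H (posproj H).
Proof.
move=> hH; have uP := spectral_unitary H; rewrite {1}(spectralE hH) ev_udiag_diag //.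
apply: sumr_ge0 => i _ /=; case: ltP => h; first by rewrite mulr1 ltW.
by rewrite mulr0.
Qed.

Lemma posproj_le0 n (H : 'M[C]_n) : ct H = H ->
  Psd (- ((1%:M - posproj H) *m H *m (1%:M - posproj H))).
Proof.
move=> hH; have uP := spectral_unitary H.
have -> : 1%:M - posproj H = fcalc (fun x : R => (x <= 0)%R%:R) H.
  rewrite /posproj /fcalc; apply/eqP; rewrite subr_eq addrC udiagD -(udiag1 uP).
  apply/eqP/eq_udiag => i /=; rewrite leNgt; case: (0 < _); rewrite ?addr0 ?add0r //.
rewrite [X in _ *m X *m _](spectralE hH) /fcalc !udiagM //.
rewrite -scaleN1r (_ : -1 = (-1 : R)%:C); last by rewrite rmorphN1.
rewrite udiagZ; apply: Psd_udiag => i /=.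
by case: (leP (specval H i) 0) => h; rewrite mulN1r ?mulr1 ?mulr0 ?mul1r ?oppr_ge0 ?oppr0.
Qed.

(* [Ft] coarse-grains the spectrum of [F] to the powers of [th] up to [th ^+ K];
   [K] will not depend on the number of sites, so pinching by [E] only costs a
   constant. *)
Lemma spectral_bins n (F : 'M[C]_n) (th : R) (K : nat) :
  Psd F -> ev F 1%:M = 1 -> 0 < th < 1 ->
  exists (E : 'I_K.+1 -> 'M[C]_n) (Ft : 'M[C]_n),
  [/\ [/\ forall k, ct (E k) = E k, \sum_k E k = 1%:M &
         forall k l, E k *m E l = if k == l then E k else 0],
      (forall k Z, Z *m F = F *m Z -> Z *m E k = E k *m Z),
      Ft = \sum_(k < K.+1) (th ^+ k)%:C *: E k,
      Psd (Ft - F) &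
      Psd (th^-1%:C *: F + (th ^+ K)%:C *: 1%:M - Ft)].
Proof.
move=> pF F1 th01; have [kf kfP] := geometric_bins K th01.
have hF := Psd_ct pF; have uV := spectral_unitary F; set V := spectralmx F in uV.
set h := specval F; have FE : F = udiag V h by apply: spectralE.
have h0 i : 0 <= h i by apply: (Psd_udiag_ge0 _ uV); rewrite -FE.
have h1 i : h i <= 1.
  rewrite -F1 FE -(udiag1 uV) ev_udiag_diag // (bigD1 i) //= mulr1 lerDl.
  by apply: sumr_ge0 => j _; rewrite mulr1.
have hk i := kfP (h i) (introT andP (conj (h0 i) (h1 i))).
have opp (W : 'M[C]_n) (g : 'I_n -> R) : - udiag W g = udiag W (fun i => - g i).
  rewrite -scaleN1r (_ : -1 = (-1 : R)%:C); last by rewrite rmorphN1.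
  by rewrite udiagZ; apply: eq_udiag => i; rewrite mulN1r.
exists (fun k => udiag V (fun i => (kf (h i) == k)%:R)), (udiag V (fun i => th ^+ kf (h i))).
split; first split.
- by move=> k; apply: ct_udiag.
- rewrite udiag_sum -(udiag1 uV); apply: eq_udiag => i /=.
  rewrite (bigD1 (kf (h i))) //= eqxx big1 ?addr0 // => k /negbTE kn.
  by rewrite eq_sym kn.
- move=> k l; rewrite udiagM //; case: eqP => [<-|kl].
    by apply: eq_udiag => i /=; case: eqP; rewrite ?mulr1 ?mulr0.
  rewrite -(udiag0 V); apply: eq_udiag => i /=.
  by case: eqP => [->|_]; rewrite ?mul0r //; case: eqP => // _; rewrite mulr0.
- move=> k Z; apply: (comm_fcalc (fun x => (kf x == k)%:R) hF).
- under eq_bigr => k _ do rewrite udiagZ.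
  rewrite udiag_sum; apply: eq_udiag => i /=.
  rewrite (bigD1 (kf (h i))) //= eqxx mulr1 big1 ?addr0 // => k /negbTE kn.
  by rewrite eq_sym kn mulr0.
- rewrite FE opp udiagD; apply: Psd_udiag => i /=.
  by rewrite subr_ge0; case: (hk i).
- rewrite FE -(udiag1 uV) opp !udiagZ !udiagD; apply: Psd_udiag => i /=.
  by rewrite mulr1 subr_ge0; case: (hk i).
Qed.

(** By commutation the cross terms vanish, and the difference is [p *m Ft *m p]. *)
Lemma comm_psd_diff n (Ft p : 'M[C]_n) : Psd Ft -> is_proj p -> Ft *m p = p *m Ft ->
  Psd (Ft - (1%:M - p) *m Ft *m (1%:M - p)).
Proof.
move=> pFt [pc pp] cFp.
have -> : Ft - (1%:M - p) *m Ft *m (1%:M - p) = ct p *m Ft *m p.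
  have E : p *m Ft *m p = p *m Ft by rewrite -mulmxA cFp mulmxA pp.
  rewrite pc mulmxBl mul1mx mulmxBr mulmx1 mulmxBl E cFp subrr subr0.
  by rewrite opprB addrC subrK.
exact: Psd_cong.
Qed.

(* The test is the support of the positive part of pinch U - e Ft: pinch U commutes with Ft, so
   the complement r of the test satisfies r (pinch U) r <= e Ft, as operators. *)
Lemma universal_test n (F U : 'M[C]_n) (th e : R) (K : nat) :
  Psd F -> ev F 1%:M = 1 -> Psd U -> 0 < th < 1 -> 0 < e ->
  exists p : 'M[C]_n,
  [/\ is_proj p,
      (forall Z, Z *m F = F *m Z -> Z *m U = U *m Z -> Z *m p = p *m Z),
      e * ev F p <= ev U 1%:M &
      forall q, is_proj q ->
        ev U ((1%:M - p) *m q *m (1%:M - p)) <=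
        K.+1%:R * e * (th^-1 * ev F q + th ^+ K * n%:R)].
Proof.
move=> pF F1 pU th01 e0.
have [E [Ft [[Ect E1 EE] cE FtE FFt FtF]]] := spectral_bins K pF F1 th01.
have pFt : Psd Ft by have := PsdD FFt pF; rewrite subrK.
have pU' := Psd_pinch Ect pU.
have cFU : Ft *m pinch E U = pinch E U *m Ft.
  rewrite FtE mulmx_suml mulmx_sumr; apply: eq_bigr => k _.
  by rewrite -scalemxAl -scalemxAr pinch_E // E_pinch.
have cU' Z : Z *m F = F *m Z -> Z *m U = U *m Z -> Z *m pinch E U = pinch E U *m Z.
  move=> ZF ZU; rewrite mulmx_suml mulmx_sumr; apply: eq_bigr => k _.
  have ZE := cE k Z ZF.
  have -> : Z *m (E k *m U *m E k) = E k *m (Z *m U) *m E k by rewrite !mulmxA ZE.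
  have -> : E k *m U *m E k *m Z = E k *m (U *m Z) *m E k.
    by rewrite -(mulmxA (E k *m U) (E k) Z) -ZE !mulmxA.
  by rewrite ZU.
(* The only place where [U] is compared with its pinching; it produces the factor [K.+1] in the
   conclusion. *)
have evl X : Psd X -> ev U X <= K.+1%:R * ev (pinch E U) X.
  move=> pX; have := ev_ge0 (pinching_ineq Ect E1 pU) pX.
  by rewrite evC evBr evZr subr_ge0 [ev X U]evC [ev X _]evC.
have trU := ev_pinch1 U E1 EE.
move: (pinch E U) pU' cFU cU' evl trU => U' pU' cFU cU' evl trU.
have hH : ct (U' - e%:C *: Ft) = U' - e%:C *: Ft by rewrite ctB ctZ !Psd_ct.
have pp := posproj_proj (U' - e%:C *: Ft).
have cp Z : Z *m (U' - e%:C *: Ft) = (U' - e%:C *: Ft) *m Z ->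
  Z *m posproj (U' - e%:C *: Ft) = posproj (U' - e%:C *: Ft) *m Z by apply: comm_fcalc.
have pos := posproj_ge0 hH; have neg := posproj_le0 hH.
exists (posproj (U' - e%:C *: Ft)).
move: (posproj _) pp cp pos neg => p pp cp pos neg {hH}.
have cFp : Ft *m p = p *m Ft.
  by apply: cp; rewrite mulmxBl mulmxBr cFU -scalemxAl -scalemxAr.
split=> //.
- move=> Z ZF ZU; apply: cp; rewrite mulmxBl mulmxBr -scalemxAl -scalemxAr.
  congr (_ - _ *: _); first exact: cU'.
  rewrite FtE mulmx_suml mulmx_sumr; apply: eq_bigr => k _.
  by rewrite -scalemxAl -scalemxAr cE.
(* Chain: [e * ev F p <= e * ev Ft p <= ev U' p <= ev U 1%:M], the middle step by positivity of
   [U' - e Ft] on [p]. *)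
- have l1 : ev F p <= ev Ft p.
    rewrite evC [X in _ <= X]evC; exact: (ev_le (is_proj_psd pp) FFt).
  have l2 : ev U' p <= ev U 1%:M.
    rewrite -trU; exact: (ev_le pU' (is_proj_psd (is_projC pp))).
  move: pos; rewrite evC evBr evZr [ev p U']evC [ev p Ft]evC.
  have := ler_wpM2l (ltW e0) l1; lra.
(* With r the complement of the test, r U' r is bounded by e r Ft r and, as r commutes with Ft, by e
   Ft. This is an operator inequality, so [q] may be any projection; the trace of [q] is then
   bounded by [n]. *)
- move=> q pq; have pq' := is_proj_psd pq.
  have pr := is_projC pp; have s2 := comm_psd_diff pFt pp cFp.
  move: (1%:M - p) pr neg s2 => r pr neg s2; have [rc rr] := pr.
  have prqr : Psd (r *m q *m r) by rewrite -{1}rc; apply: Psd_cong.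
  apply: (le_trans (evl _ prqr)); rewrite -mulrA ler_wpM2l //.
  have -> : ev U' (r *m q *m r) = ev (r *m U' *m r) q.
    by rewrite /ev mulmxA mxtrace_mulC !mulmxA.
  have s1 : ev (r *m U' *m r) q <= e * ev (r *m Ft *m r) q.
    have := ev_ge0 neg pq'.
    rewrite mulmxBr mulmxBl opprB -scalemxAr -scalemxAl evC evBr evZr.
    by rewrite [ev q _]evC [ev q (r *m U' *m r)]evC subr_ge0.
  apply: (le_trans s1); rewrite ler_pM2l //.
  apply: (@le_trans _ _ (ev q Ft)); first by rewrite evC; exact: (ev_le pq' s2).
  apply: (le_trans (ev_le pq' FtF)); rewrite evDr !evZr evC lerD2l ler_wpM2l //.
    by rewrite exprn_ge0 ?ltW //; case/andP: th01.
  rewrite evC; apply: (@le_trans _ _ (ev 1%:M (1%:M : 'M[C]_n))).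
    apply: ev_le; first exact: Psd1.
    exact: (is_proj_psd (is_projC pq)).
  by rewrite /ev mulmx1 mxtrace1 -(rmorph_nat (real_complex R)).
Qed.

End Pinching.

(** * Tensor products and marginals on the spin chain *)

Section SpinChain.
Local Open Scope complex_scope.
Context {R : realType} {m : nat} (k : 'I_m -> nat).
Local Notation C := R[i].
Local Notation Re := complex.Re.
Local Notation cfg := (cfg k).
Local Notation lmx := (@lmx R m k).

Lemma ent_mkmx n (f : cfg n -> cfg n -> C) i j : ent (mkmx f) i j = f i j.
Proof. by rewrite /ent mxE !enum_rankK. Qed.

Lemma lmxP n (X Y : lmx n) : (forall i j, ent X i j = ent Y i j) -> X = Y.
Proof.
by move=> H; apply/matrixP => a b; have := H (enum_val a) (enum_val b); rewrite /ent !enum_valK.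
Qed.

Lemma ent_mul n (X Y : lmx n) i j : ent (X *m Y) i j = \sum_h ent X i h * ent Y h j.
Proof.
rewrite /ent mxE (reindex (@enum_rank (cfg n))) //=.
by exists enum_val => ? _; rewrite ?enum_rankK ?enum_valK.
Qed.

Lemma tr_ent n (X : lmx n) : \tr X = \sum_i ent X i i.
Proof.
rewrite /mxtrace (reindex (@enum_rank (cfg n))) //=.
by exists enum_val => ? _; rewrite ?enum_rankK ?enum_valK.
Qed.

Lemma ent1 n i j : ent (1%:M : lmx n) i j = (i == j)%:R.
Proof. by rewrite /ent mxE (inj_eq enum_rank_inj). Qed.

Lemma ent_ct n (X : lmx n) i j : ent (ct X : lmx n) i j = Num.conj (ent X j i).
Proof. by rewrite /ent ctE. Qed.

(** The projection onto the configurations with block labels [b]; these projections span the centre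
    of the local algebra. *)
Definition blabel n (b : {ffun 'I_n -> 'I_m}) : lmx n :=
  diagR (fun a => [forall t, tag ((enum_val a : cfg n) t) == b t]%:R).

(* Membership in the block-diagonal algebra is a commutation property, hence is
   inherited by functional calculus. *)
Lemma inlocP n (X : lmx n) :
  inloc X <-> forall b : {ffun 'I_n -> 'I_m}, blabel b *m X = X *m blabel b.
Proof.
split=> H.
  move=> b; apply/matrixP => a a'; rewrite mul_diagR mulr_diagR mulrC.
  have [->|/eqP Xn] := eqVneq (X a a') 0; first by rewrite !mul0r.
  congr (_ * _%:C); congr (nat_of_bool _)%:R.
  have : ent X (enum_val a) (enum_val a') != 0 by rewrite /ent !enum_valK; apply/eqP.
  by move=> /H E; apply: eq_forallb => t; rewrite E.
move=> i j Xij t; pose b := [ffun t => tag (i t)].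
have /matrixP /(_ (enum_rank i) (enum_rank j)) := H b.
rewrite mul_diagR mulr_diagR !enum_rankK.
have -> : [forall t, tag (i t) == b t] by apply/forallP => s; rewrite ffunE.
case: (boolP [forall t, tag (j t) == b t]) => [/forallP/(_ t)|_].
  by rewrite ffunE => /eqP.
by rewrite mulr0 mul1r => /eqP; rewrite -/(ent X i j) (negbTE Xij).
Qed.

Lemma inlocD n (X Y : lmx n) : inloc X -> inloc Y -> inloc (X + Y).
Proof.
move=> /inlocP hX /inlocP hY; apply/inlocP => b.
by rewrite mulmxDr mulmxDl hX hY.
Qed.

Lemma inlocZ n (a : C) (X : lmx n) : inloc X -> inloc (a *: X).
Proof.
by move=> /inlocP hX; apply/inlocP => b; rewrite -scalemxAr -scalemxAl hX.
Qed.

Lemma inloc1 n : inloc (1%:M : lmx n).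
Proof. by apply/inlocP => b; rewrite mulmx1 mul1mx. Qed.

Lemma inloc0 n : inloc (0 : lmx n).
Proof. by apply/inlocP => b; rewrite mulmx0 mul0mx. Qed.

Lemma inloc_sum n (I : Type) (s : seq I) (P : pred I) (F : I -> lmx n) :
  (forall i, P i -> inloc (F i)) -> inloc (\sum_(i <- s | P i) F i).
Proof. by move=> H; elim/big_ind: _ => //; [apply: inloc0|apply: inlocD]. Qed.

Lemma inloc_fcalc n (X : lmx n) f : ct X = X -> inloc X -> inloc (fcalc f X : lmx n).
Proof.
by move=> hX /inlocP h; apply/inlocP => b; apply: comm_fcalc.
Qed.

Definition lcf l n (i : cfg (l + n)) : cfg l := [ffun s => i (lshift n s)].
Definition rcf l n (i : cfg (l + n)) : cfg n := [ffun s => i (rshift l s)].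
Definition ccat l n (a : cfg l) (b : cfg n) : cfg (l + n) :=
  [ffun t => match split t with inl s => a s | inr s => b s end].

Lemma lcf_ccat l n (a : cfg l) (b : cfg n) : lcf (ccat a b) = a.
Proof. by apply/ffunP => s; rewrite !ffunE (unsplitK (inl s)). Qed.

Lemma rcf_ccat l n (a : cfg l) (b : cfg n) : rcf (ccat a b) = b.
Proof. by apply/ffunP => s; rewrite !ffunE (unsplitK (inr s)). Qed.

Lemma ccatK l n (i : cfg (l + n)) : ccat (lcf i) (rcf i) = i.
Proof.
by apply/ffunP => t; rewrite ffunE; case: split_ordP => s ->; rewrite ffunE.
Qed.

Lemma sum_ccat l n (F : cfg (l + n) -> C) :
  \sum_i F i = \sum_a \sum_b F (ccat a b).
Proof.
rewrite pair_big /= (reindex (fun p : cfg l * cfg n => ccat p.1 p.2)) //=.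
exists (fun i => (lcf i, rcf i)) => [[a b] _|i _] /=; last exact: ccatK.
by rewrite lcf_ccat rcf_ccat.
Qed.

Definition kron l n (A : lmx l) (B : lmx n) : lmx (l + n) :=
  mkmx (fun i j => ent A (lcf i) (lcf j) * ent B (rcf i) (rcf j)).

Lemma ent_kron l n (A : lmx l) (B : lmx n) i j :
  ent (kron A B) i j = ent A (lcf i) (lcf j) * ent B (rcf i) (rcf j).
Proof. exact: ent_mkmx. Qed.

Lemma kronM l n (A A' : lmx l) (B B' : lmx n) :
  kron A B *m kron A' B' = kron (A *m A') (B *m B').
Proof.
apply: lmxP => i j; rewrite ent_mul ent_kron !ent_mul sum_ccat big_distrlr /=.
apply: eq_bigr => a _; apply: eq_bigr => b _.
by rewrite !ent_kron !lcf_ccat !rcf_ccat mulrACA.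
Qed.

Lemma kron1 l n : kron (1%:M : lmx l) (1%:M : lmx n) = 1%:M.
Proof.
apply: lmxP => i j; rewrite ent_kron !ent1 -natrM mulnb; congr (nat_of_bool _)%:R.
apply/andP/eqP => [[/eqP E1 /eqP E2]|->]; last by [].
by rewrite -(ccatK i) -(ccatK j) E1 E2.
Qed.

Lemma ct_kron l n (A : lmx l) (B : lmx n) : (ct (kron A B) : lmx _) = kron (ct A) (ct B).
Proof. by apply: lmxP => i j; rewrite ent_ct !ent_kron !ent_ct; apply: rmorphM. Qed.

Lemma tr_kron l n (A : lmx l) (B : lmx n) : \tr (kron A B) = \tr A * \tr B.
Proof.
rewrite !tr_ent sum_ccat big_distrlr /=.
apply: eq_bigr => a _; apply: eq_bigr => b _.
by rewrite ent_kron lcf_ccat rcf_ccat.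
Qed.

Lemma inloc_kron l n (A : lmx l) (B : lmx n) : inloc A -> inloc B -> inloc (kron A B).
Proof.
move=> hA hB i j; rewrite ent_kron mulf_eq0 negb_or => /andP[/hA a /hB b] t.
by case: (split_ordP t) => s ->; [have := a s|have := b s]; rewrite !ffunE.
Qed.

Definition kfun l n (op : R -> R -> R) (h : 'I_(#|cfg l|) -> R) (g : 'I_(#|cfg n|) -> R)
    (x : 'I_(#|cfg (l + n)|)) : R :=
  op (h (enum_rank (lcf (enum_val x : cfg (l + n)))))
     (g (enum_rank (rcf (enum_val x : cfg (l + n))))).

Lemma kron_diagR l n (h : 'I_(#|cfg l|) -> R) (g : 'I_(#|cfg n|) -> R) :
  kron (diagR h : lmx l) (diagR g : lmx n) = diagR (kfun *%R h g).
Proof.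
apply: lmxP => i j; rewrite ent_kron /ent !diagRE !(inj_eq enum_rank_inj) /kfun enum_rankK.
have -> : (i == j) = (lcf i == lcf j) && (rcf i == rcf j).
  apply/eqP/andP => [->//|[/eqP E1 /eqP E2]].
  by rewrite -(ccatK i) -(ccatK j) E1 E2.
case: eqP => _; last by rewrite !mulr0n mul0r.
by case: eqP => _; rewrite ?mulr0n ?mulr0 // !mulr1n RCM.
Qed.

Lemma kron_udiag l n (V : lmx l) (W : lmx n) h g :
  kron (udiag V h) (udiag W g) = udiag (kron V W) (kfun *%R h g).
Proof. by rewrite /udiag ct_kron -kron_diagR !kronM. Qed.

Lemma kron_unitary l n (V : lmx l) (W : lmx n) :
  V *m ct V = 1%:M -> W *m ct W = 1%:M -> kron V W *m ct (kron V W) = 1%:M.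
Proof. by move=> uV uW; rewrite ct_kron kronM uV uW kron1. Qed.

(** Strict positivity is what makes [ln] additive on products of eigenvalues, given the convention
    [ln 0 = 0]. *)
Lemma log_kron l n (V : lmx l) (W : lmx n) h g :
  V *m ct V = 1%:M -> W *m ct W = 1%:M -> (forall i, 0 < h i) -> (forall i, 0 < g i) ->
  fcalc (@ln R) (kron (udiag V h) (udiag W g)) =
  kron (fcalc (@ln R) (udiag V h)) 1%:M + kron 1%:M (fcalc (@ln R) (udiag W g)).
Proof.
move=> uV uW h0 g0; rewrite kron_udiag !fcalc_udiag //; last exact: kron_unitary.
rewrite -(udiag1 uV) -(udiag1 uW) !kron_udiag udiagD; apply: eq_udiag => x.
by rewrite /kfun /= mulr1 mul1r lnM ?posrE.
Qed.

Definition wcf l N (H : (l <= N)%N) (i : cfg N) : cfg l := [ffun s => i (widen_ord H s)].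

(* X (x) 1 on N sites, with a proof of [l <= N] instead of the shape [l + n], so
   that iterating [extR] needs no cast along [addnS]. *)
Definition extRN l N (H : (l <= N)%N) (X : lmx l) : lmx N :=
  mkmx (fun i j => if [forall t : 'I_N, (l <= t)%N ==> (i t == j t)]
                   then ent X (wcf H i) (wcf H j) else 0).

Lemma inloc_extRN l N (H : (l <= N)%N) (X : lmx l) : inloc X -> inloc (extRN H X).
Proof.
move=> hX i j; rewrite ent_mkmx; case: forallP => [E|_]; last by rewrite eqxx.
move=> /hX h t; have [tl|lt] := leqP l t; first by have /implyP/(_ tl)/eqP-> := E t.
have := h (Ordinal lt); rewrite !ffunE.
by have -> : widen_ord H (Ordinal lt) = t by apply: val_inj.
Qed.

Lemma extR_extRN l N (H : (l <= N)%N) (H' : (l <= N.+1)%N) (X : lmx l) :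
  extR (extRN H X) = extRN H' X.
Proof.
apply: lmxP => i j; rewrite !ent_mkmx.
have wE (x : cfg N.+1) : wcf H (restrR x) = wcf H' x.
  by apply/ffunP => s; rewrite !ffunE; congr (x _); apply: val_inj.
rewrite !wE; case: (forallP (P := fun t : 'I_N.+1 => (l <= t)%N ==> (i t == j t))) => [A|A].
  have := A ord_max; rewrite /= H /= => ->.
  case: forallP => // B; exfalso; apply: B => t; apply/implyP => lt; rewrite !ffunE.
  by have /implyP := A (widen_ord (leqnSn N) t); apply.
case: eqP => // E; case: forallP => // B; exfalso; apply: A => t; apply/implyP => lt.
have [tN|] := ltnP t N.
  have /implyP/(_ lt) := B (Ordinal tN); rewrite !ffunE.
  by have -> : widen_ord (leqnSn N) (Ordinal tN) = t by apply: val_inj.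
move=> Nt; have -> : t = ord_max; last by apply/eqP.
by apply/val_inj/eqP; rewrite /= eqn_leq Nt andbT -ltnS.
Qed.

Lemma kron_1r l n (X : lmx l) : kron X (1%:M : lmx n) = extRN (leq_addr n l) X.
Proof.
apply: lmxP => i j; rewrite ent_kron ent_mkmx ent1.
have wE (x : cfg (l + n)) : wcf (leq_addr n l) x = lcf x.
  by apply/ffunP => s; rewrite !ffunE; congr (x _); apply: val_inj.
rewrite !wE.
have -> : [forall t : 'I_(l + n), (l <= t)%N ==> (i t == j t)] = (rcf i == rcf j).
  apply/forallP/eqP => [A|E t].
    by apply/ffunP => s; rewrite !ffunE; have := A (rshift l s); rewrite /= leq_addr => /eqP.
  apply/implyP; case: (split_ordP t) => s -> /=; first by rewrite leqNgt ltn_ord.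
  by move=> _; have /ffunP/(_ s) := E; rewrite !ffunE => ->.
by case: eqP => _; rewrite ?mulr1 ?mulr0.
Qed.

(** What remains of a stationary state once the position of the interval is forgotten: dropping a
    site at either end gives the same smaller density. *)
Definition consistent (D : forall n, lmx n) : Prop :=
  [/\ forall n, density (D n),
      forall n (X : lmx n), inloc X -> \tr (D n.+1 *m extR X) = \tr (D n *m X)
    & forall n (X : lmx n), inloc X -> \tr (D n.+1 *m extL X) = \tr (D n *m X)].

Lemma stationary_consistent (Psi : @qstate R m k) : stationary Psi -> consistent (locn Psi).
Proof.
move=> [[dP rP lP] sP]; split=> [n|n X|n X]; [exact: dP|exact: rP|].
by move=> /(lP 0%R) <-; rewrite /locn -(sP (0 - 1)%R) subrK.
Qed.

Lemma marginal_left (D : forall n, lmx n) l n (X : lmx l) :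
  consistent D -> inloc X -> \tr (D (l + n)%N *m kron X 1%:M) = \tr (D l *m X).
Proof.
move=> [_ cR _] hX; rewrite kron_1r.
(* With [l + n] generalised to any [N >= l], the induction removes one site at the right end until
   [N = l]. *)
suff H N (lN : (l <= N)%N) : \tr (D N *m extRN lN X) = \tr (D l *m X) by apply: H.
elim: N lN => [|N IH] lN.
  have l0 : l = 0%N by apply/eqP; rewrite -leqn0.
  move: X hX lN; rewrite l0 => X hX lN; congr (\tr (_ *m _)).
  apply: lmxP => i j; rewrite ent_mkmx.
  have wE (x : cfg 0) : wcf lN x = x by apply/ffunP => [[]].
  by rewrite !wE; case: forallP => // A; exfalso; apply: A => [[]].
have := lN; rewrite leq_eqVlt => /orP[/eqP lE|]; last first.
  by rewrite ltnS => lN'; rewrite -(extR_extRN lN') cR ?IH //; apply: inloc_extRN.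
move: {IH} X hX lN; rewrite lE => X hX lN; congr (\tr (_ *m _)).
apply: lmxP => i j; rewrite ent_mkmx.
have wE (x : cfg N.+1) : wcf lN x = x.
  by apply/ffunP => s; rewrite ffunE; congr (x _); apply: val_inj.
rewrite !wE; case: forallP => // A; exfalso; apply: A => t.
by rewrite leqNgt ltn_ord.
Qed.

(** Induction on [l]: each step strips one identity factor at the left end, which is an [extL]. *)
Lemma marginal_right (D : forall n, lmx n) l n (X : lmx n) :
  consistent D -> inloc X -> \tr (D (l + n)%N *m kron (1%:M : lmx l) X) = \tr (D n *m X).
Proof.
move=> [_ _ cL] hX; elim: l => [|l IH].
  congr (\tr (_ *m _)); apply: lmxP => i j; rewrite ent_kron ent1.
  have -> : lcf i == lcf j by apply/eqP/ffunP => [[]].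
  have wE (x : cfg (0 + n)) : rcf x = x.
    by apply/ffunP => s; rewrite ffunE; congr (x _); apply: val_inj.
  by rewrite !wE mul1r.
suff -> : kron (1%:M : lmx l.+1) X = extL (kron (1%:M : lmx l) X).
  by rewrite -IH; apply: cL; apply: inloc_kron => //; apply: inloc1.
apply: (@lmxP (l.+1 + n)) => i j; rewrite ent_kron.
have -> : ent (extL (kron (1%:M : lmx l) X)) i j = if i ord0 == j ord0 then
    ent (kron (1%:M : lmx l) X) (restrL i) (restrL j) else 0 by apply: ent_mkmx.
rewrite ent_kron !ent1.
have wE (x : cfg (l.+1 + n)) : rcf (restrL x) = rcf x.
  by apply/ffunP => s; rewrite !ffunE; congr (x _); apply: val_inj.
rewrite !wE.
have -> : (lcf i == lcf j) = (i ord0 == j ord0) && (lcf (restrL i) == lcf (restrL j)).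
  apply/eqP/andP => [/ffunP E|[/eqP E0 /eqP/ffunP E]].
    split.
      have := E ord0; rewrite !ffunE.
      have -> : lshift n (ord0 : 'I_l.+1) = ord0 by apply: val_inj.
      by move/eqP.
    apply/eqP/ffunP => s; have := E (lift ord0 s); rewrite !ffunE.
    by have -> : lshift n (lift ord0 s) = lift ord0 (lshift n s) by apply: val_inj.
  apply/ffunP => s; rewrite !ffunE; case: (unliftP ord0 s) => [s'|] ->.
    have := E s'; rewrite !ffunE.
    by have -> : lshift n (lift ord0 s') = lift ord0 (lshift n s') by apply: val_inj.
  by have -> : lshift n (ord0 : 'I_l.+1) = ord0 by apply: val_inj.
by case: eqP => //= _; rewrite mul0r.
Qed.

End SpinChain.

(** * A universal family of block product states *)

Section Domination.
Local Open Scope complex_scope.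
Context {R : realType}.
Local Notation C := R[i].
Local Notation Re := complex.Re.

Lemma ln_le_subr1 (x : R) : 0 < x -> ln x <= x - 1.
Proof. by move=> x0; have := @le_ln1Dx R (x - 1); rewrite (addrC 1) subrK; apply; lra. Qed.

Lemma nsqM (x y : C) : nsq (x * y) = nsq x * nsq y.
Proof. by case: x y => a b [c d]; rewrite /nsq /=; ring. Qed.

Lemma nsqN (x : C) : nsq (- x) = nsq x.
Proof. by case: x => a b; rewrite /nsq /= !sqrrN. Qed.

(** The quadratic form of [X] is real and, by the arithmetic-geometric mean inequality on each
    entry, at least [- n d] times the squared norm of the vector. *)
Lemma small_entries_psd n (X : 'M[C]_n) (d : R) : ct X = X -> 0 < d ->
  (forall a b, nsq (X a b) <= d ^+ 2) -> Psd ((n%:R * d)%:C *: 1%:M + X).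
Proof.
move=> hX d0 Xd v; rewrite -/(ct v) mulmxDr mulmxDl -scalemxAr -scalemxAl mulmx1 mxE.
rewrite [X in X + _]mxE ct_mulmxE -RCM.
set z := (ct v *m X *m v) 0 0.
have zE : z = (Re z)%:C.
  have : Num.conj z = z by rewrite /z -ctE !ctM ctK hX mulmxA.
  rewrite conjCE; case: (z) => a b [ab]; apply/eqP; rewrite eq_complex /= eqxx /=.
  by apply/eqP; lra.
rewrite zE -RCD ler0c.
have -> : Re z = \sum_a \sum_b Re (Num.conj (v a 0) * (X a b * v b 0)).
  rewrite /z -mulmxA mxE Re_sum; apply: eq_bigr => a _.
  by rewrite ctE mxE mulr_sumr Re_sum.
have key a b : - Re (Num.conj (v a 0) * (X a b * v b 0)) <=
    2^-1 * d * (nsq (v a 0) + nsq (v b 0)).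
  have := ReM_le (- Num.conj (v a 0)) (X a b * v b 0) d0.
  rewrite nsqN nsq_conj nsqM mulNr ReN.
  have : nsq (X a b) * nsq (v b 0) / d <= d * nsq (v b 0).
    rewrite ler_pdivrMr // -mulrA [_ * d]mulrC mulrA -expr2 ler_wpM2r ?nsq_ge0 //.
  by lra.
rewrite -lerBlDr sub0r -sumrN.
apply: (@le_trans _ _ (\sum_a \sum_b 2^-1 * d * (nsq (v a 0) + nsq (v b 0)))).
  apply: ler_sum => a _; rewrite -sumrN; apply: ler_sum => b _; exact: key.
under eq_bigr => a _ do rewrite -mulr_sumr big_split /= sumr_const card_ord.
rewrite -mulr_sumr big_split /= sumr_const card_ord sumrMnl.
set S := \sum_i nsq (v i 0); rewrite -[S *+ n]mulr_natl; lra.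
Qed.

Lemma udiagE n (V : 'M[C]_n) h : udiag V h = ct V *m diagR h *m V.
Proof. by []. Qed.

(* After ln x <= x - 1, only the diagonal of D T^-1 D <= c D is needed:
   l_i <e_i, T^-1 e_i> <= c. *)
Lemma qrel_le_ln n (D W : 'M[C]_n) (t : 'I_n -> R) (c : R) :
  Psd D -> ev D 1%:M = 1 -> W *m ct W = 1%:M -> (forall j, 0 < t j) -> 0 < c ->
  Psd (c%:C *: udiag W t - D) -> qrel D (udiag W t) <= ln c.
Proof.
move=> /Psd_spectral[V [l [uV l0 ->]]] D1 uW t0 c0 dom.
rewrite qrel_basis //.
have l1 : \sum_i l i = 1.
  rewrite -[RHS]D1 -(udiag1 uV) ev_udiag_diag //; by apply: eq_bigr => i _; rewrite mulr1.
rewrite -[ln c]mulr1 -l1 mulr_sumr; apply: ler_sum => i _.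
set w := fun j => nsq ((V *m ct W) i j).
have w0 j : 0 <= w j by apply: nsq_ge0.
have w1 : \sum_j w j = 1 by apply: sum_nsq_row.
have [li|li] := eqVneq (l i) 0.
  by rewrite li mulr0 big1 // => j _; rewrite !mul0r.
have lp : 0 < l i by rewrite lt_neqAle eq_sym li l0.
pose y := \sum_j w j / t j.
have y0 : 0 <= y by apply: sumr_ge0 => j _; rewrite divr_ge0 // ltW.
have ly : l i * y <= c.
  have [Ti [Tict TT TG]] : exists Ti : 'M[C]_n, [/\ ct Ti = Ti, Ti *m udiag W t *m Ti = Ti
      & Ti = ct W *m diagR (fun j => (t j)^-1) *m W].
    exists (udiag W (fun j => (t j)^-1)); split => //; first exact: ct_udiag.
    rewrite udiagM // udiagM //; apply: eq_udiag => j.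
    by rewrite mulVf ?mul1r // gt_eqF.
  pose B := Ti *m ct V.
  have Bct : ct B = V *m Ti by rewrite /B ctM ctK Tict.
  have E1 : ct B *m udiag W t *m B = V *m Ti *m ct V.
    by rewrite Bct /B -{3}TT !mulmxA.
  have E2 : ct B *m udiag V l *m B = V *m Ti *m ct V *m (diagR l *m ct (V *m Ti *m ct V)).
    have -> : ct (V *m Ti *m ct V) = V *m Ti *m ct V by rewrite ctM ctK (ctM V) Tict mulmxA.
    by rewrite Bct /B (udiagE V) !mulmxA.
  have : (V *m Ti *m ct V) i i = y%:C.
    have -> : V *m Ti *m ct V = (V *m ct W) *m (diagR (fun j => (t j)^-1) *m ct (V *m ct W)).
      by rewrite TG ctM ctK !mulmxA.
    rewrite mxE RC_sum; apply: eq_bigr => j _.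
    by rewrite mul_diagR ctE mulrCA mul_conjE -RCM mulrC.
  move: (V *m Ti *m ct V) E1 E2 => Z E1 E2 Zii.
  (* Conjugating the domination by T^-1 and reading off diagonal entry [i] gives
     [l i * y ^+ 2 <= c * y], once only the term [j = i] of the sum is kept. *)
  have := Psd_diag_ge0 i (Psd_cong B dom).
  rewrite mulmxBr mulmxBl -scalemxAr -scalemxAl E1 E2 mxE [X in X + _]mxE Zii mxE.
  rewrite mxE -RCM.
  have -> : \sum_j Z i j * (diagR l *m ct Z) j i = (\sum_j l j * nsq (Z i j))%:C.
    rewrite RC_sum; apply: eq_bigr => j _.
    by rewrite mul_diagR ctE mulrCA mul_conjE -RCM.
  rewrite -RCB ler0c => H.
  have : l i * y ^+ 2 <= c * y.
    have : l i * nsq (Z i i) <= \sum_j l j * nsq (Z i j).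
      rewrite (bigD1 i) //= lerDl; apply: sumr_ge0 => j _; by rewrite mulr_ge0 ?nsq_ge0.
    by rewrite Zii {1}/nsq /= expr0n /= addr0; lra.
  have [->|yn] := eqVneq y 0; first by move=> _; rewrite mulr0 ltW.
  have yp : 0 < y by rewrite lt_neqAle eq_sym yn y0.
  by rewrite expr2 mulrA ler_pM2r.
have tn j : t j != 0 by rewrite gt_eqF.
clear dom.
(* This is ln x <= x - 1 at [x = l i / (c * t j)]. Summed over [j], the part without [ln c] is
   [l i * (l i * y / c - 1)], which is at most 0 by [ly]. *)
apply: (@le_trans _ _ (\sum_j (l i * w j * ln c + (l i * (l i * (w j / t j)) / c - l i * w j)))).
  apply: ler_sum => j _.
  have li0 := lp; have tj := t0 j.
  have := @ln_le_subr1 (l i / (c * t j)) (divr_gt0 lp (mulr_gt0 c0 tj)).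
  rewrite ln_div ?posrE ?mulr_gt0 // lnM ?posrE // => H.
  have lw : 0 <= l i * w j by rewrite mulr_ge0.
  have := ler_wpM2l lw H.
  have -> : l i * w j * (l i / (c * t j) - 1) = l i * (l i * (w j / t j)) / c - l i * w j.
    by field; rewrite tn gt_eqF.
  by rewrite -/(w j); lra.
rewrite big_split /= sumrB -!mulr_suml -!mulr_sumr w1 -/y mulr1.
have -> : l i * (l i * y) / c = l i * (l i * y / c) by rewrite -mulrA.
have : l i * y / c <= 1 by rewrite ler_pdivrMr // mul1r.
by move=> H; have := ler_wpM2l (ltW lp) H; lra.
Qed.

End Domination.

(** * Countably many faithful densities and their block products *)

Section UniversalFamily.
Local Open Scope complex_scope.
Context {R : realType} {m : nat} (k : 'I_m -> nat).
Local Notation C := R[i].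
Local Notation Re := complex.Re.
Local Notation cfg := (cfg k).
Local Notation lmx := (@lmx R m k).

(** Faithful densities: every density has its support below them, and their logarithms are additive
    under tensor products. *)
Definition posdens n (T : lmx n) : Prop :=
  [/\ inloc T, \tr T = 1 &
   exists (W : lmx n) (t : 'I_(#|cfg n|) -> R),
     [/\ W *m ct W = 1%:M, forall j, 0 < t j & T = udiag W t]].

Lemma posdens_density n (T : lmx n) : posdens T -> density T.
Proof.
by move=> [iT tT [W [t [uW t0 E]]]]; split => //; rewrite E; apply: Psd_udiag => i; apply: ltW.
Qed.

Lemma posdens_herm n (T : lmx n) : posdens T -> ct T = T.
Proof. by move=> [_ _ [W [t [_ _ ->]]]]; apply: ct_udiag. Qed.

Lemma posdens_supp n (T D : lmx n) : posdens T -> exists Y, D = T *m Y.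
Proof.
move=> [_ _ [W [t [uW t0 ->]]]]; exists (udiag W (fun j => (t j)^-1) *m D).
have E : udiag W t *m udiag W (fun j => (t j)^-1) = 1%:M.
  rewrite (udiagM _ _ uW) -(udiag1 uW).
  by apply: eq_udiag => j; rewrite divff // gt_eqF.
by rewrite mulmxA E mul1mx.
Qed.

Lemma mxtrace1_lmx n : \tr (1%:M : lmx n) = (#|cfg n|%:R : R)%:C.
Proof. by rewrite mxtrace1 -(rmorph_nat (real_complex R)). Qed.

Lemma posdens_mix n (s : lmx n) (e : R) : density s -> 0 < e ->
  posdens ((1 + e * #|cfg n|%:R)^-1%:C *: (s + e%:C *: 1%:M) : lmx n).
Proof.
move=> [is_ ps ts] e0; set c := 1 + _.
have c0 : 0 < c by rewrite ltr_wpDr ?mulr_ge0 ?ler0n // ltW.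
split.
- by apply: inlocZ; apply: inlocD => //; apply: inlocZ; apply: inloc1.
- rewrite mxtraceZ mxtraceD mxtraceZ ts mxtrace1_lmx -RCM -[1]/((1 : R)%:C) -RCD -RCM.
  by rewrite mulVf // gt_eqF.
- have [V [h [uV h0 E]]] := Psd_spectral ps.
  exists V, (fun i => c^-1 * (h i + e * 1)); split => //.
    by move=> j; rewrite mulr_gt0 ?invr_gt0 // mulr1 ltr_wpDl.
  by rewrite E -(udiag1 uV) udiagZ udiagD udiagZ.
Qed.

(* Positions of the entries of [T] on the grid of mesh 1/K; two matrices in the same
   cell are 2/K-close entrywise, and there are countably many cells. *)
Definition cell n (K : nat) (T : lmx n) : 'M[int]_(#|cfg n|) * 'M[int]_(#|cfg n|) :=
  (\matrix_(a, b) Num.floor (K%:R * Re (T a b)), \matrix_(a, b) Num.floor (K%:R * complex.Im (T a b))).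

Lemma floor_close (x y : R) (K : nat) : (0 < K)%N ->
  Num.floor (K%:R * x) = Num.floor (K%:R * y) -> (x - y) ^+ 2 <= K%:R^-1 ^+ 2.
Proof.
move=> K0 E; have K0' : (0 : R) < K%:R by rewrite ltr0n.
have := floor_itv (K%:R * x); have := floor_itv (K%:R * y).
rewrite E intrD; set f := _%:~R => /andP[a1 a2] /andP[b1 b2].
have h : x - y <= K%:R^-1 by rewrite -[X in _ <= X]mul1r ler_pdivlMr //; lra.
have h' : - (x - y) <= K%:R^-1 by rewrite -[X in _ <= X]mul1r ler_pdivlMr //; lra.
move: h h'; set z := x - y => h h'.
have : 0 <= (K%:R^-1 - z) * (K%:R^-1 + z) by apply: mulr_ge0; lra.
lra.
Qed.

(** Mixing [s] with the identity gives [T0] with [c T0 - s = e 1]. This margin absorbs the error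
    [c (T - T0)] as soon as the mesh 1/K is fine enough. *)
Lemma cell_dominates n (s : lmx n) (c : R) : (0 < #|cfg n|)%N -> density s -> 1 < c ->
  exists (K : nat) (T0 : lmx n), posdens T0 /\
    forall T : lmx n, posdens T -> cell K T = cell K T0 -> Psd (c%:C *: T - s).
Proof.
move=> d0 ds c1; set d : R := #|cfg n|%:R.
have d0' : 0 < d by rewrite ltr0n.
(* Chosen so that [c = 1 + e * d] is the normalising constant of [s + e 1]. *)
pose e := (c - 1) / d; have e0 : 0 < e by rewrite divr_gt0 // subr_gt0.
have cE : c = 1 + e * d by rewrite /e divfK ?gt_eqF // addrC subrK.
have c0 : 0 < c by lra.
(* [K > B] says that [d * (2 * c / K) < e], where [2 * c / K] bounds the entries of [X] below. *)
pose B := 2 * c * d / e.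
have B0 : 0 <= B by rewrite ltW // divr_gt0 // !mulr_gt0.
have := archi_boundP B0; set K := Num.bound B => BK.
have K0 : (0 : R) < K%:R by apply: le_lt_trans BK.
have K0' : (0 < K)%N by rewrite -(ltr0n R).
pose T0 : lmx n := c^-1%:C *: (s + e%:C *: 1%:M).
exists K, T0; split; first by rewrite /T0 cE; apply: posdens_mix.
move=> T pT /eqP; rewrite xpair_eqE => /andP[/eqP/matrixP HR /eqP/matrixP HI].
pose X : lmx n := c%:C *: (T - T0).
have hs : ct s = s by case: ds => _ ps _; apply: Psd_ct.
have hT0 : ct T0 = T0 by rewrite /T0 ctZ ctD ctZ ct1 hs.
have hX : ct X = X by rewrite /X ctZ ctB hT0 posdens_herm.
have dl0 : 0 < 2 * c / K%:R by rewrite divr_gt0 // mulr_gt0.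
have Xs a b : nsq (X a b) <= (2 * c / K%:R) ^+ 2.
  have -> : nsq (X a b) = c ^+ 2 * nsq ((T - T0) a b).
    by rewrite /X mxE nsqM; congr (_ * _); rewrite /nsq /= expr0n /= addr0.
  rewrite mxE [X in T a b + X]mxE.
  have := HR a b; rewrite [LHS]mxE [RHS]mxE => /(floor_close K0') h1.
  have := HI a b; rewrite [LHS]mxE [RHS]mxE => /(floor_close K0') h2.
  have : nsq (T a b - T0 a b) <= 4 * K%:R^-1 ^+ 2.
    have ImB (x y : C) : complex.Im (x - y) = complex.Im x - complex.Im y.
      by case: x y => x1 x2 [y1 y2].
    rewrite /nsq ReB ImB.
    have := sqr_ge0 (K%:R^-1 : R); lra.
  move=> h; have := ler_wpM2l (sqr_ge0 c) h; rewrite !exprMn exprVn; lra.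
have := small_entries_psd hX dl0 Xs; rewrite -/d => pX.
have -> : c%:C *: T - s = ((d * (2 * c / K%:R))%:C *: 1%:M + X) +
    (e - d * (2 * c / K%:R))%:C *: 1%:M.
  rewrite addrAC -scalerDl -RCD (addrC (d * _)) subrK /X /T0 scalerBr scalerA -RCM.
  rewrite mulfV ?gt_eqF // scale1r opprD [RHS]addrCA; congr (_ + _).
  by rewrite addrCA subrr addr0.
apply: (PsdD pX); apply: PsdZ; last exact: Psd1.
rewrite subr_ge0 mulrA ler_pdivrMr //.
have := BK; rewrite /B ltr_pdivrMr //; lra.
Qed.

Lemma countable_family : (forall n, 0 < #|cfg n|)%N ->
  exists F : nat -> {n & lmx n}, (forall j, posdens (projT2 (F j))) /\
    forall n (s : lmx n) (c : R), density s -> 1 < c ->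
      exists j T, F j = existT (fun n => lmx n) n T /\ Psd (c%:C *: T - s).
Proof.
move=> cfg0.
(* A default member of the family, for the cells that contain no faithful density. *)
have [x0 px0] : exists x0 : {n & lmx n}, posdens (projT2 x0).
  have t0 : (0 < #|cfg 0|%:R :> R) by rewrite ltr0n.
  exists (existT (fun n => lmx n) 0%N ((#|cfg 0|%:R : R)^-1%:C *: 1%:M)) => /=; split.
  - by apply: inlocZ; apply: inloc1.
  - by rewrite mxtraceZ mxtrace1_lmx -RCM mulVf // gt_eqF.
  - exists 1%:M, (fun=> (#|cfg 0|%:R : R)^-1 * 1); split.
    + by rewrite ct1 mulmx1.
    + by move=> j; rewrite mulr1 invr_gt0.
    + by rewrite -udiagZ udiag1 // ct1 mulmx1.
pose I : countType := {n : nat & (nat * ('M[int]_(#|cfg n|) * 'M[int]_(#|cfg n|)))%type}.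
pose P (x : I) (T : lmx (tag x)) := posdens T /\ cell (tagged x).1 T = (tagged x).2.
have pick (x : I) : exists y : {n & lmx n}, posdens (projT2 y) /\
    ((exists T, P x T) -> exists T, y = existT (fun n => lmx n) (tag x) T /\ P x T).
  have [[T pT]|nT] := pselect (exists T, P x T); last by exists x0; split.
  by exists (existT (fun n => lmx n) (tag x) T); split=> [|_]; [case: pT | exists T].
have [G GP] := choice pick.
exists (fun j => if @unpickle I j is Some x then G x else x0); split.
  by move=> j; case: unpickle => [x|//]; case: (GP x).
move=> n s c ds c1; have [K [T0 [pT0 H]]] := cell_dominates (cfg0 n) ds c1.
pose x : I := existT _ n (K, cell K T0).
have [_ [|T [GT [pT cT]]]] := GP x; first by exists T0.
by exists (pickle x), T; rewrite pickleK; split => //; apply: H.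
Qed.

(** The logarithm of a tensor product is a sum of one-sided terms, so its expectation sees only the
    two marginals of [D]; no independence between the blocks is involved. *)
Lemma block_power_step l n (T : lmx l) (W : lmx n) : posdens T -> posdens W ->
  posdens (kron T W) /\ forall D, consistent D ->
    ev (D (l + n)%N) (fcalc (@ln R) (kron T W)) =
    ev (D l) (fcalc (@ln R) T) + ev (D n) (fcalc (@ln R) W).
Proof.
move=> pT pW; have hT := posdens_herm pT; have hW := posdens_herm pW.
have [iT tT [V [t [uV t0 TE]]]] := pT; have [iW tW [V' [t' [uV' t0' WE]]]] := pW.
split.
  split; first exact: inloc_kron.
    by rewrite tr_kron tT tW mulr1.
  exists (kron V V'), (kfun *%R t t'); split; first exact: kron_unitary.
    by move=> j; apply: mulr_gt0.
  by rewrite TE WE kron_udiag.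
move=> D cD; rewrite {1}TE {1}WE log_kron // -TE -WE evDr /ev.
rewrite (marginal_left n cD); last exact: inloc_fcalc.
by rewrite (marginal_right l cD) //; apply: inloc_fcalc.
Qed.

(* W is T^{(x) n %/ l} (x) the tracial state on the remaining n %% l sites. *)
Lemma block_power l (T : lmx l) n : posdens T -> (forall n, 0 < #|cfg n|)%N ->
  exists W : lmx n, posdens W /\ forall D, consistent D ->
    ev (D n) (fcalc (@ln R) W) =
    (n %/ l)%:R * ev (D l) (fcalc (@ln R) T) - ln (#|cfg (n %% l)|%:R).
Proof.
move=> pT cfg0.
suff H N r : exists W : lmx (N * l + r)%N, posdens W /\ forall D, consistent D ->
    ev (D (N * l + r)%N) (fcalc (@ln R) W) =
    N%:R * ev (D l) (fcalc (@ln R) T) - ln (#|cfg r|%:R).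
  by have := H (n %/ l)%N (n %% l)%N; rewrite -divn_eq.
elim: N => [|N IH].
  have d0 : (0 < #|cfg r|%:R :> R) by rewrite ltr0n.
  have u1 : (1%:M : lmx r) *m ct 1%:M = 1%:M by rewrite ct1 mulmx1.
  have E : ((#|cfg r|%:R : R)^-1%:C *: 1%:M : lmx r) = udiag 1%:M (fun=> (#|cfg r|%:R : R)^-1 * 1).
    by rewrite -udiagZ udiag1.
  rewrite mul0n add0n; exists ((#|cfg r|%:R : R)^-1%:C *: 1%:M); split.
    split; first by apply: inlocZ; apply: inloc1.
      by rewrite mxtraceZ mxtrace1_lmx -RCM mulVf // gt_eqF.
    by exists 1%:M, (fun=> (#|cfg r|%:R : R)^-1 * 1); split => // j; rewrite mulr1 invr_gt0.
  move=> D [dD _ _]; rewrite E fcalc_udiag // mul0r sub0r -lnV ?posrE //.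
  rewrite -[in RHS](mulr1 (_^-1)) (@eq_udiag _ _ _ _ (fun=> ln (#|cfg r|%:R^-1 * 1) * 1)).
    rewrite -udiagZ udiag1 // evZr /ev mulmx1; case: (dD r) => _ _ ->.
    by rewrite -[Re 1]/(1 : R) !mulr1.
  by move=> i; rewrite /= !mulr1.
have [W [pW WD]] := IH; rewrite mulSn -addnA.
have [pk kD] := block_power_step pT pW.
exists (kron T W); split => // D cD; rewrite kD // WD // -natr1; ring.
Qed.

Lemma density_ev1 n (D : lmx n) : density D -> ev D 1%:M = 1.
Proof. by move=> [_ _ h]; rewrite /ev mulmx1 h. Qed.

Lemma ev_log_le0 n (D : lmx n) : density D -> ev D (fcalc (@ln R) D) <= 0.
Proof.
move=> dD; have D1 := density_ev1 dD; case: dD => _ /Psd_spectral[V [h [uV h0 E]]] _.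
rewrite E fcalc_udiag // ev_udiag_diag //.
rewrite -oppr_ge0 -sumrN; apply: sumr_ge0 => i _ /=.
rewrite -mulrN mulr_ge0 // oppr_ge0 ln_le0 //.
move: D1; rewrite E -(udiag1 uV) ev_udiag_diag // => <-.
by rewrite (bigD1 i) //= mulr1 lerDl; apply: sumr_ge0 => j _; rewrite mulr1.
Qed.

(* If h is the infimum of H n / n (H the entropy of D n) and l almost attains it, then
   the l-block products have relative entropy rate at most H l / l - h; only the
   definition of h is used, not the subadditivity of H. *)
Lemma universal_family : (forall n, 0 < #|cfg n|)%N ->
  exists W : nat -> forall n, lmx n, (forall j n, posdens (W j n)) /\
    forall D, consistent D -> forall d : R, 0 < d ->
      exists j n0, forall n, (n0 <= n)%N -> qrel (D n) (W j n) <= d * n%:R.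
Proof.
move=> cfg0; have [F [pF FP]] := countable_family cfg0.
have powF j n : exists W : lmx n, posdens W /\ forall D, consistent D ->
    ev (D n) (fcalc (@ln R) W) = (n %/ projT1 (F j))%:R *
      ev (D (projT1 (F j))) (fcalc (@ln R) (projT2 (F j))) - ln (#|cfg (n %% projT1 (F j))|%:R).
  exact: block_power.
pose W j n := projT1 (cid (powF j n)).
have pW j n : posdens (W j n) by rewrite /W; case: cid => w /= [].
have WP j n D : consistent D -> ev (D n) (fcalc (@ln R) (W j n)) =
    (n %/ projT1 (F j))%:R * ev (D (projT1 (F j))) (fcalc (@ln R) (projT2 (F j)))
    - ln (#|cfg (n %% projT1 (F j))|%:R).
  by rewrite /W; case: cid => w /= [_ H]; apply: H.
exists W; split => // D cD d d0.
have dD n : density (D n) by case: cD.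
pose H n : R := - ev (D n) (fcalc (@ln R) (D n)).
have H0 n : 0 <= H n by rewrite /H oppr_ge0 ev_log_le0.
pose E := [set x : R | exists2 n, (0 < n)%N & x = H n / n%:R].
have lbE : has_lbound E.
  by exists 0 => x [n n0 ->]; rewrite divr_ge0.
have infE : has_inf E by split => //; exists (H 1%N / 1%:R); exists 1%N.
(* The rate [d] is spent in thirds: on the choice of the block length [l], on the approximation of
   [D l] by a member of the family, and on the sites left over. *)
have [x [l l0 ->] Hl] := inf_adherent (divr_gt0 d0 (ltr0n R 3)) infE.
have Hn n : inf E * n%:R <= H n.
  case: n => [|n]; first by rewrite mulr0.
  by rewrite -ler_pdivlMr ?ltr0n //; apply: ge_inf => //; exists n.+1.
have c1 : 1 < expR (d / 3) by rewrite expR_gt1 divr_gt0.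
have [j [T [FjT dom]]] := FP l (D l) _ (dD l) c1.
have pT : posdens T by have := pF j; rewrite FjT.
have relT : qrel (D l) T <= d / 3.
  have [_ _ [V [t [uV t0 TE]]]] := pT.
  have [_ pD _] := dD l; rewrite TE in dom *; rewrite -[d / 3]expRK.
  exact: (qrel_le_ln pD (density_ev1 (dD l)) uV t0 (expR_gt0 _) dom).
(* A bound, uniform in [n], for the entropy cost of the fewer than [l] sites left over. *)
pose B : R := \sum_(r < l) ln #|cfg r|%:R.
have lnge0 r : 0 <= ln (#|cfg r|%:R : R) by rewrite ln_ge0 // ler1n.
have Bl r : (r < l)%N -> ln (#|cfg r|%:R) <= B.
  move=> rl; rewrite /B (bigD1 (Ordinal rl)) //= lerDl.
  by apply: sumr_ge0 => i _.
have B0 : 0 <= B by apply: sumr_ge0 => i _.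
exists j, (Num.bound (3 * B / d)) => n nB.
have Bn : 3 * B <= d * n%:R.
  have := archi_boundP (divr_ge0 (mulr_ge0 (ler0n R 3) B0) (ltW d0)).
  rewrite ltr_pdivrMr // => h; apply: (le_trans (ltW h)).
  by rewrite mulrC ler_pM2l // ler_nat.
have {}WP := WP j n D cD; rewrite FjT /= in WP.
have -> : qrel (D n) (W j n) = - H n - ev (D n) (fcalc (@ln R) (W j n)).
  by rewrite /qrel evBr /H opprK.
rewrite WP; set N := (n %/ l)%N; set r := (n %% l)%N.
have Tl : ev (D l) (fcalc (@ln R) T) = - H l - qrel (D l) T.
  by rewrite /H opprK /qrel evBr opprB addrC subrK.
rewrite Tl.
have rB := Bl r (ltn_pmod n l0).
have Nl : N%:R * l%:R <= n%:R :> R by rewrite -natrM ler_nat leq_trunc_div.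
have l1 : 1 <= l%:R :> R by rewrite ler1n.
have Nn : N%:R <= n%:R :> R by rewrite ler_nat leq_div.
have h0 : 0 <= inf E by apply: lb_le_inf; [case: infE | move=> y [n' _ ->]; rewrite divr_ge0].
move: Hl; rewrite ltr_pdivrMr ?ltr0n // => /ltW Hl.
have N0 : 0 <= N%:R :> R by rewrite ler0n.
have k1 := ler_wpM2l N0 Hl; have k2 := ler_wpM2l N0 relT.
have k3 := Hn n; have k4 := ler_wpM2l h0 Nl.
have d3 : 0 <= d / 3 by rewrite ltW // divr_gt0.
have k5 := ler_wpM2l d3 Nl; have k6 := ler_wpM2l d3 Nn.
clear -k1 k2 k3 k4 k5 k6 rB Bn; lra.
Qed.

End UniversalFamily.

(** * Universal projections *)

Section TestError.
Local Open Scope complex_scope.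
Context {R : realType}.
Local Notation C := R[i].
Local Notation Re := complex.Re.

Lemma ev_proj_le n (D p : 'M[C]_n) : Psd D -> is_proj p -> ev D p <= ev D 1%:M.
Proof. by move=> pD pp; exact: (ev_le pD (is_proj_psd (is_projC pp))). Qed.

(** Write [r = r (1 - q) + r q]: Cauchy-Schwarz handles the first part, and [ev_le_rel] with
    [X = r q] the second. The projections [r] and [q] need not commute. *)
Lemma ev_le_test n (D Q q r : 'M[C]_n) (M : R) :
  Psd D -> ev D 1%:M = 1 -> Psd Q -> (exists Y, D = Q *m Y) ->
  is_proj q -> is_proj r -> 1 < M ->
  ev D r <= Num.sqrt (ev D (1%:M - q)) + (Num.sqrt (M * ev Q (r *m q *m r)) +
    Num.sqrt ((qrel D Q + ev Q 1%:M) / ln M)).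
Proof.
move=> pD D1 pQ DQ pq pr M1; have [qc qq] := pq; have [rc rr] := pr.
have pq' := is_projC pq; have [q'c q'q'] := pq'.
have -> : ev D r = ev D (r *m (1%:M - q)) + ev D (r *m q).
  by rewrite -evDr -mulmxDr subrK mulmx1.
apply: lerD.
  have := ev_CS r (1%:M - q) pD; rewrite rc rr q'c q'q' => h; apply: (le_trans h).
  rewrite -[X in _ <= X]mul1r ler_wpM2r ?sqrtr_ge0 // -[X in _ <= X]sqrtr1 -D1.
  by rewrite ler_wsqrtr // ev_proj_le.
have -> : r *m q *m r = (r *m q) *m ct (r *m q).
  by rewrite ctM rc qc !mulmxA -(mulmxA r q q) qq.
apply: ev_le_rel => //.
rewrite ctM rc qc -!mulmxA (mulmxA r r q) rr.
apply: (@le_trans _ _ (ev D q)); last by rewrite -D1 ev_proj_le.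
apply: (ev_le pD).
have -> : q - q *m (r *m q) = ct q *m (1%:M - r) *m q.
  by rewrite qc mulmxBr mulmx1 mulmxBl qq mulmxA.
exact: (Psd_cong q (is_proj_psd (is_projC pr))).
Qed.

End TestError.

(** * One sequence of tests on the chain for all admissible states *)

Section UniversalProjections.
Local Open Scope complex_scope.
Context {R : realType} {m : nat} (k : 'I_m -> nat).
Local Notation C := R[i].
Local Notation Re := complex.Re.
Local Notation cfg := (cfg k).
Local Notation lmx := (@lmx R m k).

Lemma projection_is_proj n (p : lmx n) : projection p -> is_proj p.
Proof. by case. Qed.

Lemma card_cfg n : #|cfg n| = (#|site k| ^ n)%N.
Proof. by rewrite card_ffun card_ord. Qed.

Lemma stval_ev n (D X : lmx n) : stval D X = ev D X.
Proof. by []. Qed.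

(** A uniform mixture of the first [n] members: each fixed member is eventually dominated at the
    cost of a factor [n], which is negligible on the exponential scale. *)
Lemma countable_mixture (W : nat -> forall n, lmx n) : (forall j n, density (W j n)) ->
  exists U : forall n, lmx n,
    [/\ forall n, (0 < n)%N -> density (U n) &
        forall j n (X : lmx n), (j < n)%N -> Psd X -> ev (W j n) X <= n%:R * ev (U n) X].
Proof.
move=> dW; exists (fun n => (n%:R^-1 : R)%:C *: \sum_(j < n) W j n); split.
  move=> n n0; have n0' : (0 : R) < n%:R by rewrite ltr0n.
  split.
  - by apply: inlocZ; apply: inloc_sum => j _; case: (dW j n).
  - apply: (@PsdZ R _ n%:R^-1); first by rewrite invr_ge0 ltW.
    by apply: Psd_sum => j _; case: (dW j n).
  - rewrite mxtraceZ raddf_sum (eq_bigr (fun=> 1)) => [|j _]; last by case: (dW j n).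
    rewrite sumr_const card_ord -(rmorph_nat (real_complex R)) -RCM mulVf //.
    by rewrite gt_eqF.
move=> j n X jn pX; have n0 : (0 : R) < n%:R by rewrite ltr0n (leq_ltn_trans _ jn).
rewrite [ev (_ *: _) X]evC evZr mulrA mulfV ?gt_eqF // mul1r evC ev_sumr.
rewrite (bigD1 (Ordinal jn)) //= lerDl; apply: sumr_ge0 => i _.
by have [_ pWi _] := dW i n; exact: (ev_ge0 pX pWi).
Qed.

Lemma mul_expR_small (c eta z : R) : 0 <= c -> 0 < eta -> 0 < z ->
  exists n0, forall n, (n0 <= n)%N -> c * n%:R * expR (- (n%:R * eta)) <= z.
Proof.
move=> c0 e0 z0.
pose B := 4 * c / (z * eta ^+ 2).
have B0 : 0 <= B by rewrite divr_ge0 ?mulr_ge0 ?sqr_ge0 // ltW.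
have BK := archi_boundP B0.
exists (Num.bound B).+1 => n Bn.
have n0 : (0 : R) < n%:R by rewrite ltr0n (leq_trans _ Bn).
rewrite expRN ler_pdivrMr ?expR_gt0 //.
have hB : B <= n%:R by apply: (le_trans (ltW BK)); rewrite ler_nat ltnW.
have E1 : n%:R * eta / 2 <= expR (n%:R * eta / 2).
  by have := expR_ge1Dx (n%:R * eta / 2); lra.
have E0 : 0 <= n%:R * eta / 2 by rewrite divr_ge0 // mulr_ge0 // ltW.
have E2 : (n%:R * eta / 2) ^+ 2 <= expR (n%:R * eta).
  have -> : n%:R * eta = n%:R * eta / 2 + n%:R * eta / 2 by lra.
  rewrite expRD -expr2 !expr2; have -> : (n%:R * eta / 2 + n%:R * eta / 2) / 2 = n%:R * eta / 2 by lra.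
  exact: ler_pM.
apply: (@le_trans _ _ (z * (n%:R * eta / 2) ^+ 2)); last by rewrite ler_pM2l.
move: hB; rewrite /B ler_pdivrMr ?mulr_gt0 ?exprn_gt0 // => hB.
have := ler_wpM2l (ltW n0) hB; lra.
Qed.

(** Achievability of the exponent [a] against [F] at every error level; the projections may depend
    on [D] and on [eps]. *)
Definition uniform_tests (F D : forall n, lmx n) (a : R) : Prop :=
  forall eps : R, 0 < eps -> exists n0, forall n, (n0 <= n)%N ->
    exists q : lmx n, [/\ projection q, 1 - eps <= ev (D n) q & ev (F n) q <= expR (- (n%:R * a))].

(** [p] is fixed before [D] is given: it is built from [F] and the mixtures [U] alone, and giving up
    [a - b] in the exponent pays for the universality. *)
Lemma universal_projections (F : forall n, lmx n) (a b : R) :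
  (forall n, density (F n)) -> b < a ->
  exists p : forall n, lmx n,
  [/\ forall n, projection (p n),
      forall n, ev (F n) (p n) <= expR (- (n%:R * b)) &
      forall D, consistent D -> uniform_tests F D a ->
        forall z : R, 0 < z -> exists n0, forall n, (n0 <= n)%N -> 1 - z <= ev (D n) (p n)].
Proof.
move=> dF ba.
have cfg0 n : (0 < #|cfg n|)%N.
  rewrite lt0n; apply/eqP => c0; case: (dF n) => _ _.
  move=> /eqP; rewrite tr_ent big1 ?(eq_sym 0) ?oner_eq0 // => i _.
  by move: (fintype0 i); rewrite c0.
have [W [pW WP]] := @universal_family R m k cfg0.
have [U [dU UP]] := countable_mixture (fun j n => posdens_density (pW j n)).
(* One [eta] goes to the bin ratio [th = expR (- (n * eta))] and one to [M = expR (n * eta)]; the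
   exponent [2 * eta] that remains beats the factor [n] of the mixture. *)
pose eta := (a - b) / 4; have eta0 : 0 < eta by rewrite divr_gt0 // subr_gt0.
pose L := `|a| + ln (#|site k|%:R : R).
have s0 : (0 < #|site k|)%N by have := cfg0 1%N; rewrite card_cfg expn1.
have L0 : 0 <= L / eta by rewrite divr_ge0 ?addr_ge0 ?ln_ge0 ?ler1n // ltW.
(* Independent of [n], yet large enough that the lowest bin, [th ^+ K] times the dimension, is at
   most [expR (- (n * a))]. *)
pose K := Num.bound (L / eta).
have KL : L <= K%:R * eta by rewrite -ler_pdivrMr //; apply/ltW/archi_boundP.
have tail n : expR (- (n%:R * eta)) ^+ K * #|cfg n|%:R <= expR (- (n%:R * a)).
  rewrite -expRM_natl card_cfg natrX -[_%:R ^+ n]lnK; last first.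
    by rewrite posrE exprn_gt0 // ltr0n.
  rewrite lnXn ?ltr0n // -expRD ler_expR -mulr_natl.
  have := ler_norm a; have := ler_wpM2l (ler0n R n) KL; rewrite /L.
  have n0 := ler0n R n; move=> h1 h2; have := ler_wpM2l n0 h2; lra.
have test n : exists p : lmx n, [/\ projection p, ev (F n) p <= expR (- (n%:R * b)) &
    forall q, (0 < n)%N -> is_proj q -> ev (F n) q <= expR (- (n%:R * a)) ->
      ev (U n) ((1%:M - p) *m q *m (1%:M - p)) <= 2 * K.+1%:R * expR (- (n%:R * (3 * eta)))].
  case: n => [|n].
    (* At [n = 0] the mixture is not a density; the zero projection serves there. *)
    exists 0; split => //; last by rewrite evC /ev mul0mx mxtrace0 /= expR_ge0.
    by split; [apply: inloc0 | apply: ct0 | rewrite mulmx0].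
  have th01 : 0 < expR (- (n.+1%:R * eta)) < 1.
    by rewrite expR_gt0 expR_lt1 oppr_lt0 mulr_gt0.
  have [iU pU _] := dU n.+1 isT; have U1 := density_ev1 (dU n.+1 isT).
  have [iF pF _] := dF n.+1; have F1 := density_ev1 (dF n.+1).
  have [p [[pc pp] cp Fp Up]] := universal_test K pF F1 pU th01 (expR_gt0 (n.+1%:R * b)).
  exists p; split.
  - split => //; apply/inlocP => z.
    by apply: cp; move: z; apply/inlocP.
  - by move: Fp; rewrite U1 expRN -[_^-1]mul1r ler_pdivlMr ?expR_gt0 // mulrC.
  - move=> q _ pq Fq; apply: (le_trans (Up q pq)).
    have h1 : (expR (- (n.+1%:R * eta)))^-1 * ev (F n.+1) q <= expR (n.+1%:R * (eta - a)).
      rewrite -expRN opprK mulrBr expRD; apply: ler_wpM2l => //; exact: expR_ge0.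
    have h2 := tail n.+1.
    have h3 : expR (- (n.+1%:R * a)) <= expR (n.+1%:R * (eta - a)).
      by rewrite ler_expR mulrBr lerDr mulr_ge0 // ltW.
    have -> : - (n.+1%:R * (3 * eta)) = n.+1%:R * b + n.+1%:R * (eta - a).
      by rewrite /eta; field.
    rewrite expRD.
    have : 0 <= K.+1%:R * expR (n.+1%:R * b) by rewrite mulr_ge0 ?expR_ge0.
    move: (expR (n.+1%:R * b)) (expR (n.+1%:R * (eta - a))) h1 h2 h3 => x y h1 h2 h3 x0.
    have h4 : (expR (- (n.+1%:R * eta)))^-1 * ev (F n.+1) q + expR (- (n.+1%:R * eta)) ^+ K * #|cfg n.+1|%:R <= 2 * y.
      have -> : 2 * y = y + y by rewrite mulr_natl mulr2n.
      exact: (lerD h1 (le_trans h2 h3)).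
    have -> : 2 * K.+1%:R * (x * y) = K.+1%:R * x * (2 * y) by clear; ring.
    exact: ler_wpM2l.
pose p n := projT1 (cid (test n)).
have pP n : projection (p n) by rewrite /p; case: cid => ? /= [].
have pF n : ev (F n) (p n) <= expR (- (n%:R * b)) by rewrite /p; case: cid => ? /= [].
have pU n q : (0 < n)%N -> is_proj q -> ev (F n) q <= expR (- (n%:R * a)) ->
  ev (U n) ((1%:M - p n) *m q *m (1%:M - p n)) <= 2 * K.+1%:R * expR (- (n%:R * (3 * eta))).
  by rewrite /p; case: cid => ? /= [_ _]; apply.
exists p; split => // D cD tests z z0.
pose y := (z / 3) ^+ 2; have y0 : 0 < y by rewrite exprn_gt0 // divr_gt0.
have sy : Num.sqrt y = z / 3 by rewrite sqrtr_sqr ger0_norm // divr_ge0 // ltW.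
have [n1 H1] := tests y y0.
have d0 : 0 < eta * y / 2 by rewrite divr_gt0 // mulr_gt0.
have [j [n2 H2]] := WP D cD (eta * y / 2) d0.
have c0 : 0 <= 2 * K.+1%:R :> R by rewrite mulr_ge0.
have [n3 H3] := mul_expR_small c0 (mulr_gt0 (ltr0n R 2) eta0) y0.
(* The entry [j.+1] puts [W j] among the first [n] members; the last one makes the summand [+ 1] in
   the entropy term at most [eta * y / 2 * n]. *)
exists (maxn n1 (maxn n2 (maxn n3 (maxn j.+1 (Num.bound (2 / (eta * y))).+1)))) => n.
rewrite !geq_max => /and5P[/H1[q [pq Dq Fq]] /H2 relW /H3 h3 jn Bn].
have n0 : (0 < n)%N by apply: leq_ltn_trans jn.
have n0' : (0 : R) < n%:R by rewrite ltr0n.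
have dD : density (D n) by case: cD.
have [_ pD _] := dD; have D1 := density_ev1 dD.
have dW := posdens_density (pW j n); have [_ pWj _] := dW; have W1 := density_ev1 dW.
have pq' := projection_is_proj pq; have pr := is_projC (projection_is_proj (pP n)).
have M1 : 1 < expR (n%:R * eta) by rewrite expR_gt1 mulr_gt0.
have := ev_le_test pD D1 pWj (posdens_supp (D n) (pW j n)) pq' pr M1.
rewrite W1 expRK; set r := 1%:M - p n.
have -> : ev (D n) r = 1 - ev (D n) (p n) by rewrite /r evBr D1.
have t1 : Num.sqrt (ev (D n) (1%:M - q)) <= z / 3.
  by rewrite -sy; apply: ler_wsqrtr; rewrite evBr D1; clear -Dq; lra.
have prqr : Psd (r *m q *m r).
  have [rc _] := pr; rewrite -/r in rc; rewrite -{1}rc; exact: (Psd_cong _ (is_proj_psd pq')).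
have t2 : Num.sqrt (expR (n%:R * eta) * ev (W j n) (r *m q *m r)) <= z / 3.
  rewrite -sy ler_wsqrtr //; apply: le_trans h3.
  have u1 := UP j n _ jn prqr; have u2 := pU n q n0 pq' Fq.
  apply: (@le_trans _ _ (expR (n%:R * eta) * (n%:R * (2 * K.+1%:R * expR (- (n%:R * (3 * eta))))))).
    rewrite ler_pM2l ?expR_gt0 //; apply: (le_trans u1).
    by rewrite ler_pM2l.
  have -> : - (n%:R * (2 * eta)) = n%:R * eta + - (n%:R * (3 * eta)) by ring.
  rewrite expRD le_eqVlt; apply/orP; left; apply/eqP; clear; ring.
have t3 : Num.sqrt ((qrel (D n) (W j n) + 1) / (n%:R * eta)) <= z / 3.
  rewrite -sy; apply: ler_wsqrtr; rewrite (ler_pdivrMr _ _ (mulr_gt0 n0' eta0)).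
  have ey : 0 < eta * y by apply: mulr_gt0.
  have := archi_boundP (ltW (divr_gt0 (ltr0n R 2) ey)) => Bb.
  have : 2 / (eta * y) <= n%:R by apply: (le_trans (ltW Bb)); rewrite ler_nat ltnW.
  rewrite ler_pdivrMr // => h; have e1 : 1 <= eta * y / 2 * n%:R by clear -h; lra.
  have -> : y * (n%:R * eta) = eta * y / 2 * n%:R + eta * y / 2 * n%:R by clear; field.
  exact: lerD.
move: (Num.sqrt _) (Num.sqrt _) (Num.sqrt _) t1 t2 t3; clear => *; lra.
Qed.

End UniversalProjections.

(** * Exponential rates *)

Section ExtendedReals.
Local Open Scope complex_scope.
Context {R : realType}.
Implicit Types (u v : nat -> \bar R).

(** [limn_esup] is an infimum, over the eventual sets, of suprema; this lemma and the following ones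
    trade it for thresholds [n0]. *)
Lemma limn_esup_le_eventually u (x : \bar R) n0 :
  (forall n, (n0 <= n)%N -> (u n <= x)%E) -> (limn_esup u <= x)%E.
Proof.
move=> H; apply: (@le_trans _ _ (ereal_sup [set u n | n in [set n | (n0 <= n)%N]])).
  by apply: ereal_inf_lbound; exists [set n | (n0 <= n)%N] => //; exists n0.
by apply: ge_ereal_sup => _ [n /= n0n <-]; apply: H.
Qed.

Lemma limn_esup_lt_eventually u (x : \bar R) : (limn_esup u < x)%E ->
  exists n0, forall n, (n0 <= n)%N -> (u n < x)%E.
Proof.
move=> /ereal_inf_lt[_ [A [n0 _ nA] <-] Ax]; exists n0 => n n0n.
by apply: le_lt_trans Ax; apply: ereal_sup_ubound; exists n => //; apply: nA.
Qed.

Lemma limn_esup_mono_eventually u v n0 :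
  (forall n, (n0 <= n)%N -> (u n <= v n)%E) -> (limn_esup u <= limn_esup v)%E.
Proof.
move=> H; apply: le_ereal_inf_tmp => _ [A [n1 _ nA] <-].
apply: (@le_trans _ _ (ereal_sup [set u n | n in [set n | (maxn n0 n1 <= n)%N]])).
  by apply: ereal_inf_lbound; exists [set n | (maxn n0 n1 <= n)%N] => //; exists (maxn n0 n1).
apply: ge_ereal_sup => x [n /=]; rewrite geq_max => /andP[h0 h1] <-.
by apply: (le_trans (H _ h0)); apply: ereal_sup_ubound; exists n => //; apply: nA.
Qed.

Lemma limn_einf_ge_eventually u (x : \bar R) n0 :
  (forall n, (n0 <= n)%N -> (x <= u n)%E) -> (x <= limn_einf u)%E.
Proof.
move=> H; rewrite /limn_einf leeNr; apply: (@limn_esup_le_eventually _ _ n0) => n hn.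
by rewrite leeN2; apply: H.
Qed.

Lemma elog_rate_le (x y : R) n : (0 < n)%N -> 0 <= x ->
  ((n%:R^-1)%:E * elog x <= y%:E)%E = (x <= expR (n%:R * y)).
Proof.
move=> n0 x_ge0; have n0' : (0 : R) < n%:R by rewrite ltr0n.
rewrite (lee_pdivrMl _ _ n0') /elog; have [->|xn] := eqVneq x 0.
  by rewrite leNye expR_ge0.
have x0 : 0 < x by rewrite lt_neqAle eq_sym xn x_ge0.
by rewrite -EFinM lee_fin -[in RHS](lnK (x := x)) ?posrE // ler_expR.
Qed.

Lemma elog_rate_ge (x y : R) n : (0 < n)%N -> expR (n%:R * y) <= x ->
  (y%:E <= (n%:R^-1)%:E * elog x)%E.
Proof.
move=> n0 h; have n0' : (0 : R) < n%:R by rewrite ltr0n.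
have x0 : 0 < x by apply: lt_le_trans h; apply: expR_gt0.
rewrite lee_pdivlMl // /elog gt_eqF // -EFinM lee_fin -ler_expR lnK ?posrE //.
Qed.

Lemma cvg1_eventually (f : nat -> R) :
  f @ \oo --> (1 : R) -> forall z, 0 < z -> exists n0, forall n, (n0 <= n)%N -> 1 - z <= f n.
Proof.
move=> /cvgrPdist_le H z z0; have [n0 _ Hn] := H z z0; exists n0 => n /Hn /=.
by rewrite ler_norml => /andP[_ h]; lra.
Qed.

Lemma eventually_cvg1 (f : nat -> R) : (forall n, f n <= 1) ->
  (forall z, 0 < z -> exists n0, forall n, (n0 <= n)%N -> 1 - z <= f n) ->
  f @ \oo --> (1 : R).
Proof.
move=> f1 H; apply/cvgrPdist_le => z z0; have [n0 Hn] := H z z0; exists n0 => // n /= /Hn h.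
by rewrite ler_norml; apply/andP; split; have := f1 n; lra.
Qed.

End ExtendedReals.

Section EntropyLowerBound.
Local Open Scope complex_scope.
Context {R : realType}.
Local Notation C := R[i].

(** Every Nussbaum-Szkola term becomes nonnegative once the mass of [Q] is added. This excludes
    negative entropy rates in [projection_lower_bound]. *)
Lemma qrel_ge n (D Q Y : 'M[C]_n) : Psd D -> Psd Q -> D = Q *m Y ->
  0 <= qrel D Q + ev Q 1%:M.
Proof.
move=> /Psd_spectral[V [l [uV l0 ->]]] /Psd_spectral[W [t [uW t0 ->]]] E.
have one_two : 1 < 2 :> R by lra.
have K := qrel_term one_two uW l0 t0 E.
rewrite qrel_basis // -{1}(udiag1 uW) ev_udiag_diag //.
have -> : \sum_i t i * 1 = \sum_i \sum_j t j * nsq ((V *m ct W) i j).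
  rewrite exchange_big /=; apply: eq_bigr => j _; rewrite -mulr_sumr.
  by under eq_bigr => i _ do rewrite nsq_flip; rewrite sum_nsq_row.
rewrite -big_split; apply: sumr_ge0 => i _; rewrite -big_split; apply: sumr_ge0 => j _.
apply: le_trans (K i j); case: ifP => // _.
by rewrite mulr_ge0 ?ln_ge0 ?mulr_ge0 ?nsq_ge0 // ltW.
Qed.

End EntropyLowerBound.

(** * The lower bound on the probabilities of asymptotically sure projections *)

Section Converse.
Local Open Scope complex_scope.
Context {R : realType} {m : nat} (k : 'I_m -> nat).
Local Notation C := R[i].
Local Notation lmx := (@lmx R m k).

Lemma logmE n (X : lmx n) : logm X = fcalc (@ln R) X.
Proof.
rewrite /logm invmx_spectral /fcalc /udiag /diagR; congr (_ *m diag_mx _ *m _).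
by apply/rowP => i; rewrite !mxE.
Qed.

Lemma relent_le n (D F : lmx n) (y : R) : (relent D F <= y%:E)%E ->
  (exists Y, D = F *m Y) /\ qrel D F <= y.
Proof.
rewrite /relent; case: asboolP => [s|_]; last by rewrite leye_eq.
by rewrite lee_fin !logmE => h; split.
Qed.

(** Apply [ev_le_rel] with [X = p n] and [M = expR (n * b2)] for some [b2] between [b1] and [b]. The
    entropy term stays below 1 by a fixed gap, so [M * ev (F n) (p n)] is bounded away from 0. *)
Lemma projection_lower_bound (D F p : forall n, lmx n) (b1 b : R) :
  (forall n, density (D n)) -> (forall n, density (F n)) -> b1 < b ->
  (exists n0, forall n, (n0 <= n)%N -> (relent (D n) (F n) <= (n%:R * b1)%:E)%E) ->
  (forall n, projection (p n)) ->
  (forall z, 0 < z -> exists n0, forall n, (n0 <= n)%N -> 1 - z <= ev (D n) (p n)) ->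
  exists n0, forall n, (n0 <= n)%N -> expR (- (n%:R * b)) <= ev (F n) (p n).
Proof.
move=> dD dF b1b [n1 H1] pp cv.
(* Here [b1 < 0], so the relative entropies would tend to minus infinity, against the bound -1 from
   [qrel_ge]; no [n] beyond the threshold exists. *)
have [b0|b0] := leP b 0.
  exists (maxn n1 (Num.bound (1 / - b1)).+1) => n; rewrite geq_max => /andP[/H1/relent_le[[Y E] h] Bn].
  have [_ pD _] := dD n; have [_ pF _] := dF n.
  have := qrel_ge pD pF E; rewrite (density_ev1 (dF n)) => h'.
  have b10 : 0 < - b1 by rewrite oppr_gt0; exact: lt_le_trans b0.
  have Bb := archi_boundP (ltW (divr_gt0 (ltr01 : 0 < 1 :> R) b10)).
  have : 1 / - b1 < n%:R by apply: (lt_trans Bb); rewrite ltr_nat.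
  by rewrite ltr_pdivrMr // => h''; exfalso; clear -h h' h''; lra.
pose c1 := Num.max b1 0; have c10 : 0 <= c1 by rewrite le_max lexx orbT.
have bc : b1 <= c1 by rewrite le_max lexx.
have cb : c1 < b by rewrite gt_max b1b b0.
pose b2 := (c1 + b) / 2; have b20 : 0 < b2 by rewrite /b2; lra.
have c1b2 : c1 < b2 by rewrite /b2; lra.
have b2b : b2 < b by rewrite /b2; lra.
pose s := c1 / b2; have s1 : s < 1 by rewrite /s ltr_pdivrMr // mul1r.
have s0 : 0 <= s by rewrite divr_ge0 // ltW.
pose g := (1 - s) / 2; have g0 : 0 < g by rewrite /g; lra.
have [n2 H2] := cv (g / 2) (divr_gt0 g0 (ltr0n R 2)).
have g2 : 0 < (g / 2) ^+ 2 by rewrite exprn_gt0 // divr_gt0.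
have bb0 : 0 < b - b2 by lra.
have [n3 H3] := mul_expR_small ler01 bb0 g2.
have gb : 0 < g ^+ 2 * b2 by rewrite mulr_gt0 // exprn_gt0.
exists (maxn n1 (maxn n2 (maxn n3 (Num.bound (1 / (g ^+ 2 * b2))).+1))) => n.
rewrite !geq_max => /and4P[/H1/relent_le[supp h1] /H2 h2 /H3 h3 Bn].
have n0 : (0 < n)%N by apply: leq_ltn_trans Bn.
have n0' : (0 : R) < n%:R by rewrite ltr0n.
have [_ pD _] := dD n; have [_ pF _] := dF n; have D1 := density_ev1 (dD n).
have F1 := density_ev1 (dF n).
have [pc pq] := projection_is_proj (pp n).
have M1 : 1 < expR (n%:R * b2) by rewrite expR_gt1 mulr_gt0.
have X1 : ev (D n) (ct (p n) *m p n) <= 1.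
  rewrite pc pq -D1; exact: (ev_proj_le pD (projection_is_proj (pp n))).
have := ev_le_rel pD D1 pF supp X1 M1; rewrite pc pq F1 expRK.
set y := ev (F n) (p n) in h3 *.
have y0 : 0 <= y by exact: (ev_ge0 pF (is_proj_psd (projection_is_proj (pp n)))).
have t1 : Num.sqrt ((qrel (D n) (F n) + 1) / (n%:R * b2)) <= 1 - g.
  have e1 : 1 / (g ^+ 2 * b2) <= n%:R.
    have Bb := archi_boundP (ltW (divr_gt0 (ltr01 : 0 < 1 :> R) gb)).
    by apply: (le_trans (ltW Bb)); rewrite ler_nat ltnW.
  have g1 : 0 <= 1 - g by rewrite /g; clear -s0; lra.
  rewrite -[1 - g]ger0_norm // -sqrtr_sqr; apply: ler_wsqrtr.
  rewrite (ler_pdivrMr _ _ (mulr_gt0 n0' b20)).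
  have e2 : 1 <= n%:R * (g ^+ 2 * b2) by rewrite -ler_pdivrMr.
  have e3 : s * b2 = c1 by rewrite /s divfK // gt_eqF.
  have e4 : n%:R * b1 <= n%:R * c1 by rewrite ler_pM2l.
  (* As [s = 1 - 2 * g], the square of [1 - g] is [s + g ^+ 2]; the part [g ^+ 2] absorbs the
     summand [+ 1] for large [n]. *)
  have -> : (1 - g) ^+ 2 * (n%:R * b2) = n%:R * (s * b2) + n%:R * (g ^+ 2 * b2).
    by rewrite /g; field.
  rewrite e3; apply: lerD => //; exact: le_trans e4.
have [] := leP (g / 2) (Num.sqrt (expR (n%:R * b2) * y)); last by move=> a1 a2; exfalso; clear -h2 t1 a1 a2; lra.
move=> gy _.
have : (g / 2) ^+ 2 <= expR (n%:R * b2) * y.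
  rewrite -[X in _ <= X]sqr_sqrtr ?mulr_ge0 ?expR_ge0 //.
  by rewrite ler_pXn2r ?nnegrE ?sqrtr_ge0 // ltW // divr_gt0.
move: h3; rewrite mul1r => h3 h4.
have h5 : expR (- (n%:R * (b - b2))) <= expR (n%:R * b2) * y.
  apply: le_trans h4; apply: le_trans h3.
  by rewrite -[X in X <= _]mul1r ler_wpM2r ?expR_ge0 // ler1n.
have -> : - (n%:R * b) = - (n%:R * b2) + - (n%:R * (b - b2)) by ring.
by rewrite expRD expRN -ler_pdivlMl ?invr_gt0 ?expR_gt0 // invrK.
Qed.

End Converse.

(** * Translation of the bounds into rates of states on the chain *)

Section SpinChainRates.
Context {R : realType} {m : nat} (k : 'I_m -> nat).
Local Notation lmx := (@lmx R m k).
Local Notation qstate := (@qstate R m k).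
Implicit Types (Psi Phi : qstate) (p : forall n, lmx n).

Lemma state_density Phi n : is_state Phi -> density (locn Phi n).
Proof. by case=> h _ _; apply: h. Qed.

Lemma state_proj_ge0 Phi n (p : lmx n) : is_state Phi -> projection p ->
  0 <= stval (locn Phi n) p.
Proof.
move=> sP /projection_is_proj pp; have [_ pD _] := state_density n sP.
exact: (ev_ge0 pD (is_proj_psd pp)).
Qed.

Lemma state_proj_le1 Phi n (p : lmx n) : is_state Phi -> projection p ->
  stval (locn Phi n) p <= 1.
Proof.
move=> sP /projection_is_proj pp; have dD := state_density n sP.
have [_ pD _] := dD; rewrite -(density_ev1 dD); exact: (ev_proj_le pD pp).
Qed.

Lemma HP_uniform_tests Psi Phi (a : R) : is_state Phi ->
  HP_condition Psi Phi -> (a%:E < srate Psi Phi)%E ->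
  uniform_tests (locn Phi) (locn Psi) a.
Proof.
move=> sPhi [_ HP] aS eps eps0.
(* The HP-condition concerns levels in (0,1) only; a smaller level gives a stronger test. *)
pose e := Num.min eps (2^-1).
have e01 : 0 < e < 1.
  by rewrite lt_min eps0 invr_gt0 ltr0n /= gt_min; apply/orP; right; lra.
have : (betabar e Psi Phi < (- a)%:E)%E.
  by apply: (le_lt_trans (HP e e01)); rewrite EFinN lteN2.
move=> /limn_esup_lt_eventually[n0 H]; exists (maxn n0 1) => n.
rewrite geq_max => /andP[/H Hn n1].
move: Hn; rewrite lte_pdivrMl ?ltr0n // => /ereal_inf_lt[_ [q [pq eq] <-] lq].
exists q; split => //.
  apply: le_trans eq; by rewrite lerD2l lerN2 ge_min lexx.
have := state_proj_ge0 sPhi pq; rewrite -mulrN stval_ev => q0.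
by rewrite -elog_rate_le // lee_pdivrMl ?ltr0n // ltW.
Qed.

Lemma liminf_projection_rate Psi Phi p (b : R) :
  is_state Psi -> is_state Phi -> srate_exists Psi Phi -> (srate Psi Phi < b%:E)%E ->
  (forall n, projection (p n)) -> (fun n => stval (locn Psi n) (p n)) @ \oo --> (1 : R) ->
  ((- b)%:E <= limn_einf (logrseq Phi p))%E.
Proof.
move=> sPsi sPhi [l lS] Sb pp cv.
have lE : srate Psi Phi = l by apply/cvg_lim.
rewrite lE in Sb.
have [b1 b1b lb1] : exists2 b1 : R, b1 < b & (l < b1%:E)%E.
  move: l Sb {lS lE} => [r| |] //; rewrite ?lte_fin => rb.
    by exists ((r + b) / 2); rewrite ?lte_fin; lra.
  by exists (b - 1); rewrite ?ltNyr //; lra.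
have [_ sup] := cvg_limn_einf_sup lS; move: lb1; rewrite -sup => /limn_esup_lt_eventually[n0 H].
have rel_le : exists n0, forall n, (n0 <= n)%N ->
    (relent (locn Psi n) (locn Phi n) <= (n%:R * b1)%:E)%E.
  exists (maxn n0 1) => n; rewrite geq_max => /andP[/H h n1].
  by move: h; rewrite lte_pdivrMl ?ltr0n // => /ltW.
have [n2 H2] := projection_lower_bound (fun n => state_density n sPsi)
  (fun n => state_density n sPhi) b1b rel_le pp (cvg1_eventually cv).
apply: (@limn_einf_ge_eventually _ _ _ (maxn n2 1)) => n; rewrite geq_max => /andP[/H2 h n1].
by apply: elog_rate_ge => //; rewrite mulrN.
Qed.

Lemma liminf_projection_srate Psi Phi p :
  is_state Psi -> is_state Phi -> srate_exists Psi Phi ->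
  (forall n, projection (p n)) -> (fun n => stval (locn Psi n) (p n)) @ \oo --> (1 : R) ->
  (- limn_einf (logrseq Phi p) <= srate Psi Phi)%E.
Proof.
move=> sPsi sPhi ex pp cv.
have H (b : R) : (srate Psi Phi < b%:E)%E -> (- limn_einf (logrseq Phi p) <= b%:E)%E.
  by move=> /(liminf_projection_rate sPsi sPhi ex) h; rewrite leeNl -EFinN; apply: h.
move: (srate Psi Phi) (- limn_einf _)%E H => [r| |] x H.
- by apply/lee_addgt0Pr => e e0; apply: H; rewrite lte_fin ltrDl.
- exact: leey.
- move: x H => [x| |] // H.
    by have := H (x - 1) (ltNyr _); rewrite lee_fin => h; exfalso; clear -h; lra.
  by have := H 0 (ltNyr _); rewrite leye_eq.
Qed.

(** A number [a] below the infimum lies below every single rate, so all states of [Omega] have tests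
    of exponent [a] and share the universal projections. *)
Lemma universal_sequence Phi (Omega : set qstate) (a b : R) :
  is_state Phi -> (forall Psi, Omega Psi -> stationary Psi /\ HP_condition Psi Phi) ->
  b < a -> (a%:E < srate_set Omega Phi)%E ->
  exists p, [/\ forall n, projection (p n),
    forall Psi, Omega Psi -> (fun n => stval (locn Psi n) (p n)) @ \oo --> (1 : R) &
    (limn_esup (logrseq Phi p) <= (- b)%:E)%E].
Proof.
move=> sPhi OH ba aS.
have [p [pp pb pP]] := universal_projections (fun n => state_density n sPhi) ba.
exists p; split => // [Psi OPsi|].
  have [stPsi hp] := OH _ OPsi; have [sPsi _] := stPsi.
  apply: eventually_cvg1; first by move=> n; apply: state_proj_le1.
  apply: pP; first exact: stationary_consistent.
  apply: HP_uniform_tests => //; apply: (lt_le_trans aS).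
  by apply: ereal_inf_lbound; exists Psi.
apply: (@limn_esup_le_eventually _ _ _ 1) => n n1.
rewrite elog_rate_le //; last exact: state_proj_ge0.
by rewrite mulrN; apply: pb.
Qed.

Lemma projection1 n : projection (1%:M : lmx n).
Proof. by split; [apply: inloc1|apply: ct1|rewrite mulmx1]. Qed.

(** From some [n] on, [p n] competes in the infimum that defines [beta_n]. *)
Lemma betabar_le_of_projections Psi Phi (x : \bar R) p (eps : R) : 0 < eps ->
  (forall n, projection (p n)) -> (fun n => stval (locn Psi n) (p n)) @ \oo --> (1 : R) ->
  (limn_esup (logrseq Phi p) <= x)%E -> (betabar eps Psi Phi <= x)%E.
Proof.
move=> e0 pp /cvg1_eventually/(_ eps e0)[n0 H] px; apply: le_trans px.
apply: (@limn_esup_mono_eventually _ _ _ n0) => n /H h.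
apply: lee_wpmul2l; first by rewrite lee_fin invr_ge0.
by apply: ereal_inf_lbound; exists (p n).
Qed.

End SpinChainRates.

(** * Equivalence of the HP-condition with the existence of common optimal projections *)

Unset Implicit Arguments.

Theorem mainTheorem1 (R : realType) (m : nat) (k : 'I_m -> nat)
  (Phi : @qstate R m k) (Theta : set (@qstate R m k)) :
  is_state Phi -> (forall Psi, Theta Psi -> ergodic Psi) ->
  ((forall Psi, Theta Psi -> HP_condition Psi Phi) <->
   ((forall Psi, Theta Psi -> srate_exists Psi Phi) /\
    forall Omega : set (@qstate R m k), Omega `<=` Theta ->
      (forall eta : R, 0 < eta ->
         exists p : forall n, @lmx R m k n,
           [/\ forall n, projection (p n),
               forall Psi, Omega Psi ->
                 (fun n => stval (locn Psi n) (p n)) @ \oo --> (1 : R),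
               (srate_set Omega Phi < +oo)%E ->
                 (limn_esup (logrseq Phi p) <= - srate_set Omega Phi + eta%:E)%E
             & srate_set Omega Phi = +oo%E ->
                 (limn_esup (logrseq Phi p) <= (- eta^-1)%:E)%E]) /\
      (forall pt : forall n, @lmx R m k n,
         (forall n, projection (pt n)) ->
         (forall Psi, Omega Psi ->
            (fun n => stval (locn Psi n) (pt n)) @ \oo --> (1 : R)) ->
         (- srate_set Omega Phi <= limn_einf (logrseq Phi pt))%E))).
Proof.
move=> sPhi erg; split=> [HP|[ex H]].
  split=> [Psi /HP[]//|Omega sub].
  have OH Psi : Omega Psi -> stationary Psi /\ HP_condition Psi Phi.
    by move=> /sub T; split; [case: (erg _ T)|apply: HP].
  split=> [eta eta0|pt ppt cv]; last first.
    rewrite leeNl; apply: le_ereal_inf_tmp => _ [Psi OPsi <-].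
    have [[sPsi _] [exPsi _]] := OH _ OPsi.
    by apply: liminf_projection_srate => //; apply: cv.
  (* At the value -oo the required upper bound is +oo, so the identity projections suffice. *)
  case: (boolP (srate_set Omega Phi == -oo%E)) => [/eqP sE|sn].
    exists (fun n => 1%:M); split => [n|Psi OPsi||].
    - exact: projection1.
    - have [[sPsi _] _] := OH _ OPsi.
      under eq_fun => n do rewrite stval_ev (density_ev1 (state_density n sPsi)).
      exact: cvg_cst.
    - by rewrite sE /= leey.
    - by rewrite sE.
  have [[r rE]|sE] : (exists r, srate_set Omega Phi = r%:E) \/ srate_set Omega Phi = +oo%E.
    by move: sn; case: (srate_set Omega Phi) => [r| |] // _; [left; exists r|right].
  - have ba : r - eta < r - eta / 2 by lra.
    have aS : ((r - eta / 2)%:E < srate_set Omega Phi)%E by rewrite rE lte_fin; lra.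
    have [p [pp pc pb]] := universal_sequence sPhi OH ba aS.
    exists p; split => //; rewrite rE // => _.
    by rewrite -EFinN -EFinD (_ : - r + eta = - (r - eta)) //; lra.
  (* This case includes an empty [Omega], whose infimum is +oo. *)
  - have ba : eta^-1 < eta^-1 + 1 by lra.
    have aS : ((eta^-1 + 1)%:E < srate_set Omega Phi)%E by rewrite sE ltry.
    have [p [pp pc pb]] := universal_sequence sPhi OH ba aS.
    by exists p; split => //; rewrite sE.
move=> Psi TPsi; split; first exact: ex.
move=> eps /andP[eps0 _].
(* The converse uses singletons only, for which the infimum is the rate of [Psi] itself. *)
have sub : [set Psi] `<=` Theta by move=> _ ->.
have sE : srate_set [set Psi] Phi = srate Psi Phi.
  by rewrite /srate_set image_set1 ereal_inf1.
have [{}H _] := H _ sub.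
case sP : (srate Psi Phi) => [r| |]; rewrite sP in sE.
- apply/lee_addgt0Pr => e e0; have [p [pp pc pb _]] := H e e0.
  apply: (betabar_le_of_projections eps0 pp); first exact: pc.
  by move: pb; rewrite sE; apply; rewrite ltry.
(* Taking [eta = - y^-1] turns the bound [- eta^-1] into [y]; as [y] is arbitrary, [betabar] must be
   -oo. *)
- have K (y : R) : y < 0 -> (betabar eps Psi Phi <= y%:E)%E.
    move=> y0; have e0 : 0 < - y^-1 by rewrite oppr_gt0 invr_lt0.
    have [p [pp pc _ pb]] := H _ e0.
    apply: (betabar_le_of_projections eps0 pp); first exact: pc.
    by have := pb sE; rewrite invrN invrK opprK.
  move: (betabar _ _ _) K => [x| |] K //=.
  + have y0 : - (`|x| + 1) < 0 by rewrite oppr_lt0 ltr_wpDl.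
    have := K _ y0; rewrite lee_fin => h; have := ler_norm (- x); rewrite normrN => h'.
    by exfalso; clear -h h'; lra.
  + by have := K (-1) (ltrN10 R); rewrite leye_eq.
- by rewrite /= leey.
Qed.
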